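(* Let $m\ge2$ and let $\Omega\subset\mathbb{R}^m$ be a body with a piecewise $C^1$ boundary such that every boundary point $z\in\partial\Omega$ satisfies the following condition: there are positive constants $\varepsilon$ and $\theta$ such that $B_\varepsilon(z)\cap\Omega^c$ contains a cone of revolution with vertex $z$ and cone angle $\theta$ (the vertex itself excepted). Then for every $\alpha\in\mathbb{R}$, $\Omega$ has an $r^{\alpha-m}$-center in its minimal unfolded region $Uf(\Omega)$.
   Context: A body is a compact subset of $\mathbb{R}^m$ that is the closure of its interior. $\mu$ is Lebesgue measure on $\mathbb{R}^m$, $B_\varepsilon(x)$ is the ball with center $x$ and radius $\varepsilon$, $\Omega^c$ is the complement of $\Omega$, and $A(S^{m-1})=2\pi^{m/2}/\Gamma(m/2)$. The (renormalized) potential $V^{(\alpha)}_\Omega$ ($\alpha\in\mathbb{R}$) is defined as follows. (i) If $\alpha\le 0$ and $x\in\operatorname{int}\Omega$: for $\alpha<0$, $$V^{(\alpha)}_\Omega(x)=\lim_{\varepsilon\to+0}\left(\int_{\Omega\setminus B_\varepsilon(x)}|x-y|^{\alpha-m}\,d\mu(y)-\frac{A(S^{m-1})}{-\alpha}\cdot\frac1{\varepsilon^{-\alpha}}\right),$$ and for $\alpha=0$, $$V^{(0)}_\Omega(x)=\lim_{\varepsilon\to+0}\left(\int_{\Omega\setminus B_\varepsilon(x)}|x-y|^{-m}\,d\mu(y)-A(S^{m-1})\log\frac1\varepsilon\right).$$ (ii) If $\alpha>0$ or $x\notin\Omega$: $V^{(\alpha)}_\Omega(x)=\int_{\Omega}|x-y|^{\alpha-m}\,d\mu(y)$.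 The log potential is $V_\Omega^{\log}(x)=-\int_\Omega\log|x-y|\,d\mu(y)$. An $r^{\alpha-m}$-center of $\Omega$ is a point at which the following extreme value is attained: the minimum of $V_\Omega^{(\alpha)}$ on $\mathbb{R}^m$ if $\alpha>m$; the maximum of $V_\Omega^{\log}$ on $\mathbb{R}^m$ if $\alpha=m$; the maximum of $V_\Omega^{(\alpha)}$ on $\mathbb{R}^m$ if $0<\alpha<m$; the maximum of $V_\Omega^{(\alpha)}$ restricted to $\operatorname{int}\Omega$ if $\alpha\le0$. Minimal unfolded region: for $v\in S^{m-1}$ and $b\in\mathbb{R}$ put $M_v=\sup_{x\in\Omega}x\cdot v$, $\Omega^+_{v,b}=\Omega\cap\{x\in\mathbb{R}^m\mid x\cdot v>b\}$, and let $\mathrm{Refl}_{v,b}$ be the reflection of $\mathbb{R}^m$ in the hyperplane $\{x\mid x\cdot v=b\}$. Put $$l_v=\inf\{a\mid a\le M_v,\ \mathrm{Refl}_{v,b}(\Omega^+_{v,b})\subset\Omega\ \text{for all } b \text{ with } a\le b\le M_v\},$$ $$Uf(\Omega)=\bigcap_{v\in S^{m-1}}\{x\in\mathbb{R}^m\mid x\cdot v\le l_v\}.$$ *)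

(* Defs.v *)
From HB Require Import structures.
From mathcomp Require Import all_boot all_order all_algebra.
From mathcomp Require Import all_classical all_reals all_analysis.

Set Implicit Arguments.
Unset Strict Implicit.
Unset Printing Implicit Defensive.
Import Order.TTheory GRing.Theory Num.Theory.
Import numFieldNormedType.Exports.
Local Open Scope classical_set_scope.
Local Open Scope ring_scope.

(* The product sigma-algebra on row vectors, as for n.-tuple T in the library;
   for T = R it is the Borel sigma-algebra of R^n. *)
Definition measure_rV_display : measure_display -> measure_display.
Proof. exact. Qed.

Section measurable_rV.
Context {d} {T : measurableType d} (n : nat).

Let coors : 'I_n -> 'rV[T]_n -> T := fun i x => x 0 i.

Let rV_set0 : g_sigma_preimage coors set0.
Proof. exact: sigma_algebra0. Qed.

Let rV_setC A : g_sigma_preimage coors A -> g_sigma_preimage coors (~` A).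
Proof. exact: sigma_algebraC. Qed.

Let rV_bigcup (F : _^nat) : (forall i, g_sigma_preimage coors (F i)) ->
  g_sigma_preimage coors (\bigcup_i (F i)).
Proof. exact: sigma_algebra_bigcup. Qed.

HB.instance Definition _ := @isMeasurable.Build (measure_rV_display d)
  'rV[T]_n (g_sigma_preimage coors) rV_set0 rV_setC rV_bigcup.

Lemma measurable_coord_rV (i : 'I_n) :
  measurable_fun [set: 'rV[T]_n] (fun x => x 0 i).
Proof.
move=> _ Y mY; rewrite setTI; apply: sub_sigma_algebra => /=.
rewrite -bigcup_seq/=; exists i => /=; first by rewrite mem_index_enum.
by exists Y => //; rewrite setTI.
Qed.

Lemma measurable_fun_rVP d1 (T1 : measurableType d1) (f : T1 -> 'rV[T]_n) :
  (forall i, measurable_fun [set: T1] (fun x => f x 0 i)) ->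
  measurable_fun [set: T1] f.
Proof.
move=> mf _ A mA; rewrite setTI.
have : g_sigma_preimage coors `<=` [set B | measurable (f @^-1` B)].
  apply: smallest_sub.
    split => //=; first by rewrite preimage_set0.
      by move=> B mB; rewrite setTD preimage_setC; exact: measurableC.
    by move=> F mF; rewrite preimage_bigcup; exact: bigcup_measurable.
  rewrite -bigcup_seq => B [i _ [C mC <-]]/=.
  by rewrite setTI; have := mf i measurableT C mC; rewrite setTI.
exact.
Qed.

End measurable_rV.

Section lebesgue_rV.
Context {R : realType}.

Definition rV_cons n (p : measurableTypeR R * 'rV[R]_n) : 'rV[R]_n.+1 :=
  \row_i (if unlift ord0 i is Some j then p.2 0 j else p.1 : R).

Lemma measurable_rV_cons n : measurable_fun setT (@rV_cons n).
Proof.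
apply: measurable_fun_rVP => i.
case: (unliftP ord0 i) => [j|] ->.
  rewrite [X in measurable_fun _ X](_ : _ =
      (fun x : 'rV[R]_n => x 0 j : R) \o snd); last first.
    by apply/funext => x /=; rewrite mxE liftK.
  by apply: measurableT_comp => //; exact: measurable_coord_rV.
rewrite [X in measurable_fun _ X](_ : _ = fst); last first.
  by apply/funext => x /=; rewrite mxE unlift_none.
exact: measurable_fst.
Qed.

(* The product of Lebesgue measure on R with nu, transported to R^(n+1). *)
Definition lebesgue_cons n (nu : set 'rV[R]_n -> \bar R) :
    set 'rV[R]_n.+1 -> \bar R :=
  pushforward (lebesgue_measure \x nu)%E (@rV_cons n).

Section lebesgue_cons.
Variables (n : nat) (nu : {sigma_finite_measure set 'rV[R]_n -> \bar R}).
Local Open Scope ereal_scope.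

Let mcons : {measure set 'rV[R]_n.+1 -> \bar R} :=
  measure_function_pushforward__canonical__measure_function_Measure
    (@lebesgue_measure R \x nu) (@measurable_rV_cons n).

Let lebesgue_cons0 : lebesgue_cons nu set0 = 0.
Proof. exact: (measure0 mcons). Qed.

Let lebesgue_cons_ge0 A : 0 <= lebesgue_cons nu A.
Proof. exact: (measure_ge0 mcons). Qed.

Let lebesgue_cons_sigma_additive : semi_sigma_additive (lebesgue_cons nu).
Proof. exact: (@measure_semi_sigma_additive _ _ _ mcons). Qed.

HB.instance Definition _ := isMeasure.Build _ _ _ (lebesgue_cons nu)
  lebesgue_cons0 lebesgue_cons_ge0 lebesgue_cons_sigma_additive.

Lemma rV_cons_preimage_box (A : 'I_n.+1 -> set R) :
  @rV_cons n @^-1` [set x : 'rV[R]_n.+1 | forall i, A i (x 0%R i)] =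
  A ord0 `*` [set x : 'rV[R]_n | forall i, A (lift ord0 i) (x 0%R i)].
Proof.
apply/seteqP; split=> -[a v] /=.
  move=> h; split; first by have := h ord0; rewrite mxE unlift_none.
  by move=> i; have := h (lift ord0 i); rewrite mxE liftK.
move=> [h0 h1] i; rewrite mxE.
by case: (unliftP ord0 i) => [j|] ->.
Qed.

Lemma measurable_box (m : nat) (A : 'I_m -> set R) :
  (forall i, measurable (A i)) ->
  measurable [set x : 'rV[R]_m | forall i, A i (x 0%R i)].
Proof.
move=> mA; rewrite [X in measurable X](_ : _ =
    \bigcap_(i in [set: 'I_m]) ((fun x : 'rV[R]_m => x 0%R i) @^-1` A i)).
  apply: fin_bigcap_measurable => [|i _]; first exact: finite_finset.
  by rewrite -[X in measurable X]setTI; apply: (@measurable_coord_rV _ R).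
by apply/seteqP; split=> x /= h i; [move=> _; exact: h|exact: h].
Qed.

Lemma lebesgue_cons_box (A : 'I_n.+1 -> set R) :
  (forall i, measurable (A i)) ->
  lebesgue_cons nu [set x : 'rV[R]_n.+1 | forall i, A i (x 0%R i)] =
  lebesgue_measure (A ord0) *
  nu [set x : 'rV[R]_n | forall i, A (lift ord0 i) (x 0%R i)].
Proof.
move=> mA; rewrite /lebesgue_cons /pushforward rV_cons_preimage_box.
rewrite product_measure1E//; first exact: mA.
apply: (@measurable_box n (fun i => A (lift ord0 i))) => i; exact: mA.
Qed.

Let lebesgue_cons_sigma_finite : sigma_finite setT (lebesgue_cons nu).
Proof.
have /sigma_finiteP[F [TF ndF Foo]] := sigma_finiteT (@lebesgue_measure R).
have /sigma_finiteP[G [TG ndG Goo]] := sigma_finiteT nu.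
pose tl (y : 'rV[R]_n.+1) : measurableTypeR R * 'rV[R]_n :=
  (y 0%R ord0, \row_j y 0%R (lift ord0 j)).
have mtl : measurable_fun setT tl.
  apply/measurable_fun_pair; first exact: measurable_coord_rV.
  apply: measurable_fun_rVP => i /=.
  rewrite [X in measurable_fun _ X](_ : _ =
      (fun y : 'rV[R]_n.+1 => y 0%R (lift ord0 i))).
    exact: measurable_coord_rV.
  by apply/funext => y; rewrite mxE.
have tlK p : tl (rV_cons p) = p.
  case: p => a v; rewrite /tl mxE unlift_none /=; congr pair.
  by apply/rowP => j; rewrite !mxE liftK.
have UFG : \bigcup_k (F k `*` G k) = setT.
  rewrite -setXTT TF TG predeqE => -[x y]; split.
    by move=> [n' _ []/= ? ?]; split; exists n'.
  move=> [/= [j _ Fnx] [k _ Gky]]; exists (maxn j k) => //; split.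
  - by move: x Fnx; exact/subsetPset/ndF/leq_maxl.
  - by move: y Gky; exact/subsetPset/ndG/leq_maxr.
exists (fun k => tl @^-1` (F k `*` G k)).
  by rewrite -preimage_bigcup UFG preimage_setT.
move=> k; have [mF ?] := Foo k; have [mG ?] := Goo k; split.
  by rewrite -[X in measurable X]setTI; apply: mtl => //; exact: measurableX.
rewrite /lebesgue_cons /pushforward -comp_preimage.
rewrite (_ : tl \o _ = id) ?preimage_id; last by apply/funext => p /=.
by rewrite product_measure1E// lte_mul_pinfty// ge0_fin_numE.
Qed.

HB.instance Definition _ := @Measure_isSigmaFinite.Build _ _ _
  (lebesgue_cons nu) lebesgue_cons_sigma_finite.

End lebesgue_cons.

(* Lebesgue measure on R^n; lebesgue_rV_box below gives its value on boxes. *)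
Fixpoint lebesgue_rV n : set 'rV[R]_n -> \bar R :=
  match n with
  | 0 => dirac (0 : 'rV[R]_0)
  | n'.+1 => lebesgue_cons (@lebesgue_rV n')
  end.

Let lebesgue_rV_ex n :
  exists mu : {sigma_finite_measure set 'rV[R]_n -> \bar R},
  @lebesgue_rV n = mu.
Proof.
elim: n => [|n [nu nuE]]; first by exists (dirac (0 : 'rV[R]_0)).
by exists (lebesgue_cons nu); rewrite /= nuE.
Qed.

Section lebesgue_rV_measure.
Variable n : nat.

Let lebesgue_rV0 : @lebesgue_rV n set0 = 0%E.
Proof. by have [mu ->] := lebesgue_rV_ex n; exact: measure0. Qed.

Let lebesgue_rV_ge0 A : (0 <= @lebesgue_rV n A)%E.
Proof. by have [mu ->] := lebesgue_rV_ex n; exact: measure_ge0. Qed.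

Let lebesgue_rV_sigma_additive : semi_sigma_additive (@lebesgue_rV n).
Proof.
by have [mu ->] := lebesgue_rV_ex n; exact: measure_semi_sigma_additive.
Qed.

HB.instance Definition _ := isMeasure.Build _ _ _ (@lebesgue_rV n)
  lebesgue_rV0 lebesgue_rV_ge0 lebesgue_rV_sigma_additive.

Let lebesgue_rV_sigma_finite : sigma_finite setT (@lebesgue_rV n).
Proof. by have [mu ->] := lebesgue_rV_ex n; exact: sigma_finiteT. Qed.

HB.instance Definition _ := @Measure_isSigmaFinite.Build _ _ _
  (@lebesgue_rV n) lebesgue_rV_sigma_finite.

End lebesgue_rV_measure.

Lemma lebesgue_rV_box n (A : 'I_n -> set R) : (forall i, measurable (A i)) ->
  lebesgue_rV [set x : 'rV[R]_n | forall i, A i (x 0 i)] =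
  (\prod_(i < n) lebesgue_measure (A i))%E.
Proof.
elim: n A => [|n IH] A mA /=.
  by rewrite big_ord0 diracE mem_set// => -[].
rewrite big_ord_recl lebesgue_cons_box//; congr *%E.
exact: (IH (fun i => A (lift ord0 i))).
Qed.

End lebesgue_rV.

Section euclidean.
Context {R : realType} {m : nat}.
Implicit Types (x y v : 'rV[R]_m) (A : set 'rV[R]_m).

Definition dotv x y : R := \sum_(i < m) x 0 i * y 0 i.

(* The library's norm on 'rV[R]_m is the sup norm. *)
Definition enorm x : R := Num.sqrt (dotv x x).

Definition eball x (e : R) : set 'rV[R]_m := [set y | enorm (y - x) < e].

Definition esphere : set 'rV[R]_m := [set v | enorm v = 1].

Definition boundary A : set 'rV[R]_m := closure A `\` A°.

Definition body A : Prop := compact A /\ A = closure A°.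

(* The right circular cone with vertex z, axis direction u, aperture theta
   (the angle between the axis and a generatrix is theta / 2) and height h. *)
Definition cone_of_revolution (z u : 'rV[R]_m) (theta h : R) : set 'rV[R]_m :=
  [set y | enorm (y - z) * cos (theta / 2) <= dotv (y - z) u <= h].

Definition exterior_cone_condition A (z : 'rV[R]_m) : Prop :=
  exists e theta : R, [/\ 0 < e, 0 < theta < pi &
    exists (u : 'rV[R]_m) (h : R), [/\ esphere u, 0 < h &
      cone_of_revolution z u theta h `\ z `<=` eball z e `&` ~` A]].

End euclidean.

(* phi is C^1 on a neighbourhood of K, and restricts to an injective immersion
   of the interior of K; on the boundary of K it may degenerate, as polar
   coordinates do at the apex of a cone. *)
Definition C1_patch {R : realType} (n p : nat) (K : set 'rV[R]_n)
    (phi : 'rV[R]_n -> 'rV[R]_p) : Prop :=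
  [/\ exists U : set 'rV[R]_n, [/\ open U, K `<=` U &
        forall w, U w -> differentiable phi w /\
                         {for w, continuous (jacobian phi)}],
      set_inj K° phi &
      forall w : 'rV[R]_n, K° w -> row_free (jacobian phi w)].

(* The boundary is a finite union of C^1 patches, parametrized by bodies of
   R^(m-1) with negligible boundary; the images of their interiors are pairwise
   disjoint. *)
Definition piecewise_C1_boundary {R : realType} (m : nat)
    (Omega : set 'rV[R]_m) : Prop :=
  exists (k : nat) (K : 'I_k -> set 'rV[R]_m.-1)
         (phi : 'I_k -> 'rV[R]_m.-1 -> 'rV[R]_m),
    [/\ forall i, [/\ body (K i), lebesgue_rV (boundary (K i)) = 0%E &
                     C1_patch (K i) (phi i)],
        forall i j, i != j -> phi i @` (K i)° `&` phi j @` (K j)° = set0 &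
        boundary Omega = \bigcup_(i in [set: 'I_k]) phi i @` K i].

Definition Gamma {R : realType} (s : R) : R :=
  \int[lebesgue_measure]_(t in `]0%R, +oo[%classic) (t `^ (s - 1) * expR (- t)).

(* The area of the unit sphere of R^m. *)
Definition sphere_area {R : realType} (m : nat) : R :=
  2 * pi `^ (m%:R / 2) / Gamma (m%:R / 2).

Definition divergent_part {R : realType} (m : nat) (alpha e : R) : R :=
  if alpha == 0 then sphere_area m * ln (1 / e)
  else sphere_area m / (- alpha) * (1 / e `^ (- alpha)).

Section potential.
Context {R : realType} {m : nat}.
Implicit Types (Omega : set 'rV[R]_m) (x : 'rV[R]_m) (alpha e : R).

Definition riesz_integral alpha (A : set 'rV[R]_m) x : \bar R :=
  (\int[lebesgue_rV (n := m)]_(y in A) (enorm (x - y) `^ (alpha - m%:R))%:E)%E.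

(* For alpha <= 0 and x on the boundary of Omega the potential is left
   undefined in the mathematics; the second branch is a dummy value there. *)
Definition potential alpha Omega x : \bar R :=
  if `[< alpha <= 0 /\ Omega° x >] then
    lim ((riesz_integral alpha (Omega `\` eball x e) x
          - (divergent_part m alpha e)%:E)%E @[e --> 0^'+])
  else riesz_integral alpha Omega x.

Definition log_potential Omega x : \bar R :=
  (- \int[lebesgue_rV (n := m)]_(y in Omega) (ln (enorm (x - y)))%:E)%E.

Definition min_on (D : set 'rV[R]_m) (f : 'rV[R]_m -> \bar R) x : Prop :=
  D x /\ forall y, D y -> (f x <= f y)%E.

Definition max_on (D : set 'rV[R]_m) (f : 'rV[R]_m -> \bar R) x : Prop :=
  D x /\ forall y, D y -> (f y <= f x)%E.

Definition is_center alpha Omega x : Prop :=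
  if alpha > m%:R then min_on setT (potential alpha Omega) x
  else if alpha == m%:R then max_on setT (log_potential Omega) x
  else if alpha > 0 then max_on setT (potential alpha Omega) x
  else max_on Omega° (potential alpha Omega) x.

End potential.

Section unfolded_region.
Context {R : realType} {m : nat}.
Implicit Types (Omega : set 'rV[R]_m) (v x : 'rV[R]_m) (a b : R).

Definition support_value Omega v : R := sup [set dotv x v | x in Omega].

Definition cap Omega v b : set 'rV[R]_m := Omega `&` [set x | b < dotv x v].

Definition reflection v b x : 'rV[R]_m := x - (2 * (dotv x v - b)) *: v.

Definition fold_level Omega v : R :=
  inf [set a | a <= support_value Omega v /\
    forall b, a <= b <= support_value Omega v ->
      reflection v b @` cap Omega v b `<=` Omega].

Definition minimal_unfolded_region Omega : set 'rV[R]_m :=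
  \bigcap_(v in esphere) [set x | dotv x v <= fold_level Omega v].

End unfolded_region.

(* Main.v *)
From HB Require Import structures.
Require Import Defs.
From mathcomp Require Import all_boot all_order all_algebra.
From mathcomp Require Import all_classical all_reals all_analysis.
From mathcomp Require Import measurable_realfun ring lra.
(** For every alpha a center maximizes an attraction towards Omega: the
    potential if alpha < m, the logarithmic potential if alpha = m, minus the
    potential if alpha > m. Let rho be so large that the ball of radius rho
    about x contains Omega. What x receives from Omega is what it receives from
    this ball, less the share of the complement of Omega. The first quantity
    does not depend on x. For alpha <= 0 it is infinite, but the integral over
    the shell between the radii e and rho is a constant plus exactly the
    divergent part that the renormalization subtracts. Hence in all
    cases the objective is a constant minus the defect, the integral over the
    complement of Omega of a nonnegative decreasing kernel that vanishes beyond
    rho ([objective_defect_pos], [objective_defect_nonpos]).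

    Existence. The complement of Omega is open, so the defect is lower
    semicontinuous ([defect_lsc]) and has a minimum on every compact set. If
    alpha > 0, a point outside a ball that contains Omega is worse than the
    nearest point of the ball, its mirror image in a hyperplane that misses
    Omega, so a minimum on the ball is global ([center_exists_pos]). If
    alpha <= 0, the kernel is not integrable over a cone near its vertex, so
    the exterior cones make the defect infinite on the boundary
    ([defect_boundary]), and its minimum on Omega is taken in the interior
    ([center_exists_nonpos]).

    Position. Suppose that x lies beyond a hyperplane above the fold level in
    the direction v. The part of Omega beyond the hyperplane folds into Omega
    ([fold_inside]), and Omega is not symmetric in the hyperplane
    ([fold_strict]). Pairing each point with its mirror image shows that the
    mirror image of x has a strictly smaller defect ([defect_reflection_lt]).
    So a center lies beyond no such hyperplane, which puts it in the minimal
    unfolded region ([center_minimal_unfolded_region]).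

    Both the invariance of Lebesgue measure under reflections and its behaviour
    under scalings follow from the uniqueness of translation invariant measures
    ([lebesgue_rV_haar]). Scaling yields polar coordinates on cones
    ([integral_cone_radial]), and the Gaussian integral then identifies the
    constant in front of the divergent part with the area of the unit sphere
    ([sphere_area_volume]). *)

Set Implicit Arguments.
Unset Strict Implicit.
Unset Printing Implicit Defensive.
Import Order.TTheory GRing.Theory Num.Theory.
Import numFieldNormedType.Exports.
Local Open Scope classical_set_scope.
Local Open Scope ring_scope.

(** * Euclidean geometry of row vectors *)

Section euclidean_space.
Context {R : realType} {m : nat}.
Implicit Types (x y z v : 'rV[R]_m) (a b : R).

Lemma dotvC x y : dotv x y = dotv y x.
Proof. by apply: eq_bigr => i _; rewrite mulrC. Qed.

Lemma dotvDl x y z : dotv (x + y) z = dotv x z + dotv y z.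
Proof. by rewrite -big_split; apply: eq_bigr => i _; rewrite mxE mulrDl. Qed.

Lemma dotvZl a x y : dotv (a *: x) y = a * dotv x y.
Proof. by rewrite mulr_sumr; apply: eq_bigr => i _; rewrite mxE mulrA. Qed.

Lemma dotvNl x y : dotv (- x) y = - dotv x y.
Proof. by rewrite -scaleN1r dotvZl mulN1r. Qed.

Lemma dotvBl x y z : dotv (x - y) z = dotv x z - dotv y z.
Proof. by rewrite dotvDl dotvNl. Qed.

Lemma dotvDr x y z : dotv x (y + z) = dotv x y + dotv x z.
Proof. by rewrite dotvC dotvDl !(dotvC x). Qed.

Lemma dotvZr a x y : dotv x (a *: y) = a * dotv x y.
Proof. by rewrite dotvC dotvZl dotvC. Qed.

Lemma dotvNr x y : dotv x (- y) = - dotv x y.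
Proof. by rewrite dotvC dotvNl dotvC. Qed.

Definition dotvE := (dotvDl, dotvDr, dotvNl, dotvNr, dotvZl, dotvZr).

Lemma dotvv_ge0 x : 0 <= dotv x x.
Proof. by apply: sumr_ge0 => i _; rewrite -expr2 sqr_ge0. Qed.

Lemma coord_sqr_le_dotvv x i : x 0 i ^+ 2 <= dotv x x.
Proof.
rewrite /dotv (bigD1 i)//= -expr2 lerDl; apply: sumr_ge0 => j _.
by rewrite -expr2 sqr_ge0.
Qed.

Lemma dotvv_eq0 x : (dotv x x == 0) = (x == 0).
Proof.
apply/eqP/eqP => [x0|->]; last by rewrite /dotv big1// => i _; rewrite mxE mul0r.
apply/rowP => i; rewrite mxE; apply/eqP; rewrite -sqrf_eq0.
by rewrite eq_le sqr_ge0 -x0 coord_sqr_le_dotvv.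
Qed.

Lemma enorm_ge0 x : 0 <= enorm x. Proof. exact: sqrtr_ge0. Qed.

Lemma sqr_enorm x : enorm x ^+ 2 = dotv x x.
Proof. by rewrite sqr_sqrtr// dotvv_ge0. Qed.

Lemma enorm_eq0 x : (enorm x == 0) = (x == 0).
Proof. by rewrite -sqrf_eq0 sqr_enorm dotvv_eq0. Qed.

Lemma enorm0 : enorm (0 : 'rV[R]_m) = 0.
Proof. by apply/eqP; rewrite enorm_eq0. Qed.

Lemma enorm_gt0 x : (0 < enorm x) = (x != 0).
Proof. by rewrite lt_neqAle enorm_ge0 andbT eq_sym enorm_eq0. Qed.

Lemma enormN x : enorm (- x) = enorm x.
Proof. by rewrite /enorm !dotvE opprK. Qed.

Lemma enormB x y : enorm (x - y) = enorm (y - x).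
Proof. by rewrite -enormN opprB. Qed.

Lemma enormZ a x : enorm (a *: x) = `|a| * enorm x.
Proof.
by rewrite /enorm !dotvE mulrA -expr2 sqrtrM ?sqr_ge0// sqrtr_sqr.
Qed.

Lemma coord_le_enorm x i : `|x 0 i| <= enorm x.
Proof.
rewrite -(@ler_pXn2r _ 2)// ?nnegrE ?enorm_ge0//.
by rewrite sqr_enorm real_normK ?num_real// coord_sqr_le_dotvv.
Qed.

Lemma dotv_le x y : dotv x y <= enorm x * enorm y.
Proof.
have [->|x0] := eqVneq x 0.
  by rewrite /dotv big1 ?mulr_ge0 ?enorm_ge0// => i _; rewrite mxE mul0r.
have [->|y0] := eqVneq y 0.
  by rewrite /dotv big1 ?mulr_ge0 ?enorm_ge0// => i _; rewrite mxE mulr0.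
have := dotvv_ge0 (enorm y *: x - enorm x *: y).
rewrite !dotvE (dotvC y x) -!sqr_enorm => h.
have n0 : 0 < enorm x * enorm y by rewrite mulr_gt0// enorm_gt0.
rewrite -(ler_pM2l n0); nra.
Qed.

Lemma ler_enormD x y : enorm (x + y) <= enorm x + enorm y.
Proof.
rewrite -(@ler_pXn2r _ 2)// ?nnegrE ?addr_ge0 ?enorm_ge0//.
rewrite sqr_enorm !dotvE (dotvC y x) -!sqr_enorm.
by have := dotv_le x y; nra.
Qed.

Lemma ltr_enorm x y : (enorm x < enorm y) = (dotv x x < dotv y y).
Proof. by rewrite -!sqr_enorm ltr_pXn2r// nnegrE enorm_ge0. Qed.

Lemma ler_enorm x y : (enorm x <= enorm y) = (dotv x x <= dotv y y).
Proof. by rewrite -!sqr_enorm ler_pXn2r// nnegrE enorm_ge0. Qed.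

Lemma dotv_continuous v : continuous (fun x : 'rV[R]_m => dotv x v).
Proof.
apply: continuous_big => [|i _ x]; first exact: add_continuous.
by apply: continuousM; [exact: coord_continuous|exact: cst_continuous].
Qed.

Lemma dotvv_continuous : continuous (fun x : 'rV[R]_m => dotv x x).
Proof.
apply: continuous_big => [|i _ x]; first exact: add_continuous.
by apply: continuousM; exact: coord_continuous.
Qed.

Lemma enorm_continuous : continuous (@enorm R m).
Proof.
move=> x; apply: (@continuous_comp _ _ _ (fun x : 'rV[R]_m => dotv x x)).
  exact: dotvv_continuous.
exact: sqrt_continuous.
Qed.

Lemma enormB_continuous z : continuous (fun x : 'rV[R]_m => enorm (x - z)).
Proof.
move=> x; apply: (@continuous_comp _ _ _ (fun x : 'rV[R]_m => x - z)).
  by apply: continuousB; [move=> ?; exact: cvg_id|exact: cst_continuous].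
exact: enorm_continuous.
Qed.

Lemma eball_open z (e : R) : open (eball z e).
Proof.
apply: (@open_comp _ _ (fun x : 'rV[R]_m => enorm (x - z)) [set t | t < e]).
  by move=> x _; exact: enormB_continuous.
exact: open_lt.
Qed.

Lemma nbhs_eball z (U : set 'rV[R]_m) :
  nbhs z U -> exists2 d, 0 < d & eball z d `<=` U.
Proof.
move=> /nbhs_ballP[d /= d0 dU]; exists d => // y zy; apply: dU.
split => // i j; rewrite /ball/= ord1 distrC.
by apply: le_lt_trans zy; have := coord_le_enorm (y - z) j; rewrite !mxE.
Qed.

Lemma compact_eball (K : set 'rV[R]_m) z :
  compact K -> exists2 r, 0 < r & K `<=` eball z r.
Proof.
move=> cK.
have : bounded_set [set enorm (x - z) | x in K].
  apply: compact_bounded; apply: continuous_compact => //.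
  by apply: continuous_subspaceT; exact: enormB_continuous.
move=> [M [_ /(_ (`|M| + 1))]] h.
exists (`|M| + 2) => [|x Kx]; first by have := normr_ge0 M; lra.
have /h/(_ (enorm (x - z))) : M < `|M| + 1 by have := ler_norm M; lra.
rewrite /= (ger0_norm (enorm_ge0 _)) => le; rewrite /eball/=.
by apply: le_lt_trans (le _) _; [exists x|lra].
Qed.

Lemma closed_eball_compact (r : R) : compact [set x : 'rV[R]_m | enorm x <= r].
Proof.
apply: bounded_closed_compact.
  exists r; split; first exact: num_real.
  move=> M rM x /= xr; rewrite [`|x|]mx_normrE; apply: (bigmax_le _ _).
    by apply: le_trans (enorm_ge0 x) _; lra.
  by move=> [i j] _ /=; rewrite ord1; have := coord_le_enorm x j; lra.
apply: (@closed_comp _ _ (@enorm R m) [set t | t <= r]).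
  by move=> x _; exact: enorm_continuous.
exact: closed_le.
Qed.

Lemma measurable_dotv v : measurable_fun setT (fun x : 'rV[R]_m => dotv x v).
Proof.
apply: measurable_sum => i; apply: measurable_funM => //.
exact: measurable_coord_rV.
Qed.

Lemma measurable_dotvv : measurable_fun setT (fun x : 'rV[R]_m => dotv x x).
Proof.
by apply: measurable_sum => i; apply: measurable_funM; exact: measurable_coord_rV.
Qed.

Lemma measurable_enorm : measurable_fun setT (@enorm R m).
Proof.
apply: (measurableT_comp _ measurable_dotvv).
by apply: continuous_measurable_fun; exact: sqrt_continuous.
Qed.

(** Rational boxes form a countable base, so the product sigma-algebra contains
    the topology. *)
Lemma open_measurable_rV (U : set 'rV[R]_m) : open U -> measurable U.
Proof.
move=> oU.
pose B (p : 'rV[rat]_m * nat) : set 'rV[R]_m :=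
  [set x | forall i, `](ratr (p.1 0%R i) - p.2.+1%:R^-1),
    (ratr (p.1 0%R i) + p.2.+1%:R^-1)[%classic (x 0 i)].
have -> : U = \bigcup_(p in [set p | B p `<=` U]) B p.
  apply/seteqP; split=> [x Ux|x [p /= pU /pU//]].
  have /nbhs_ballP[d /= d0 dU] : nbhs x U by exact: open_nbhs_nbhs.
  have [n _ nd] := near_infty_natSinv_lt (PosNum (divr_gt0 d0 (ltr0Sn R 1))).
  have {}nd : n.+1%:R^-1 < d / 2 by exact: nd n (leqnn n).
  have n0 : 0 < n.+1%:R^-1 :> R by rewrite invr_gt0 ltr0n.
  set c := n.+1%:R^-1 : R in nd n0.
  have q i : exists q : rat, x 0 i - c < ratr q < x 0 i + c.
    have [|q] := @rat_in_itvoo R (x 0 i - c) (x 0 i + c); first lra.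
    by rewrite in_itv /=; exists q.
  have [f fq] := choice q.
  exists (\row_i f i, n) => [y By /=|i /=]; last first.
    by rewrite in_itv/= mxE -/c; have := fq i; lra.
  apply: dU; split => // i j; rewrite /ball/= ord1.
  have := By j; have := fq j; rewrite /= in_itv/= mxE -/c ltr_norml; lra.
rewrite bigcup_mkcond; apply: countable_bigcupT_measurable => [|p].
  exact: countableP.
case: ifP => // _; apply: (@measurable_box R m (fun i => `](ratr (p.1 0 i) - p.2.+1%:R^-1),
  (ratr (p.1 0 i) + p.2.+1%:R^-1)[%classic)) => i; exact: measurable_itv.
Qed.

Lemma closed_measurable_rV (A : set 'rV[R]_m) : closed A -> measurable A.
Proof.
by move=> cA; rewrite -[A]setCK; apply: measurableC;
  apply: open_measurable_rV; exact: closed_openC.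
Qed.

End euclidean_space.

(** * Boxes and translations *)

Section lebesgue_box.
Context {R : realType}.
Local Notation leb m := (@lebesgue_rV R m).
Local Open Scope ereal_scope.

(** Boxes are stable under intersection, so measures that agree on them agree
    everywhere; translations are then checked one coordinate at a time. *)
Lemma measurable_rV_box_generated m :
  @measurable _ 'rV[R]_m = <<s [set X | exists2 A : 'I_m -> set R,
    (forall i, measurable (A i)) & X = [set x : 'rV[R]_m | forall i, A i (x 0%R i)]] >>.
Proof.
apply/seteqP; split; last first.
  apply: smallest_sub; first exact: sigma_algebra_measurable.
  by move=> _ [A mA ->]; exact: measurable_box.
apply: smallest_sub; first exact: smallest_sigma_algebra.
rewrite -bigcup_seq => B [i _ [C mC <-]] /=.
apply: sub_sigma_algebra; exists (fun j => if j == i then C else setT).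
  by move=> j; case: ifP.
rewrite setTI; apply/seteqP; split=> [x Cx j|x /(_ i)]; last by rewrite eqxx.
by case: eqP => [->|].
Qed.


Definition cube m (r : R) : set 'rV[R]_m :=
  [set x | forall i, `[(- r)%R, r]%classic (x 0%R i)].
Arguments cube : clear implicits.

Lemma measurable_cube m (r : R) : measurable (cube m r).
Proof. exact: (@measurable_box R m (fun=> `[(- r)%R, r]%classic)). Qed.

Lemma lebesgue_rV_cube m (r : R) : (0 < r)%R ->
  leb m (cube m r) = ((2 * r) ^+ m)%:E.
Proof.
move=> r0; rewrite (@lebesgue_rV_box R m (fun=> `[(- r)%R, r]%classic))//.
rewrite (eq_bigr (fun=> (2 * r)%:E)) => [|i _].
  by rewrite prodEFin big_const_ord iter_mulr_1.
rewrite lebesgue_measure_itv/= lte_fin ifT; last lra.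
by rewrite -EFinB; congr EFin; ring.
Qed.

Lemma cube_bigcup m : \bigcup_(k : nat) cube m k%:R = setT.
Proof.
apply/seteqP; split => // x _.
have [M0 xM] : exists M : nat, forall i, (`|x 0%R i| <= M%:R)%R.
  pose N : R := (\big[Order.max/0]_i `|x 0 i|)%R.
  exists (Num.bound N) => i; apply: (@le_trans _ _ N); first exact: le_bigmax.
  by apply/ltW/archi_boundP; apply: bigmax_ge_id.
by exists M0 => // i /=; rewrite in_itv/= -ler_norml.
Qed.

Lemma lebesgue_rV_unique m (mu nu : {measure set 'rV[R]_m -> \bar R}) :
  (forall k : nat, mu (cube m k%:R) < +oo) ->
  (forall A : 'I_m -> set R, (forall i, measurable (A i)) ->
    mu [set x | forall i, A i (x 0%R i)] =
    nu [set x | forall i, A i (x 0%R i)]) ->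
  forall A, measurable A -> mu A = nu A.
Proof.
move=> fin munu A mA.
apply: (measure_unique _ (fun k => cube m k%:R) (measurable_rV_box_generated m)) => //.
- move=> _ _ [B mB ->] [C mC ->]; exists (fun i => B i `&` C i).
    by move=> i; exact: measurableI.
  by apply/seteqP; split => [x [Bx Cx] i|x BC]; split => // i; case: (BC i).
- by move=> k; exists (fun=> `[(- k%:R)%R, k%:R]%classic).
- exact: cube_bigcup.
- by move=> _ [B mB ->]; exact: munu.
Qed.

Lemma lebesgue_measure_shift (a : R) (A : set R) : measurable A ->
  lebesgue_measure [set t | A (t + a)%R] = lebesgue_measure A.
Proof.
move=> mA.
have mf : measurable_fun setT
    ((fun t => (t + a)%R) : measurableTypeR R -> measurableTypeR R).
  by apply: measurable_funD => //; exact: measurable_cst.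
pose nu := measure_function_pushforward__canonical__measure_function_Measure
    (@lebesgue_measure R) mf.
suff h X : ocitv X -> lebesgue_measure X = nu X.
  exact/esym/(lebesgue_measure_unique h).
move=> [[c d]] _ <- /=; rewrite /pushforward (_ : _ @^-1` _ = `](c - a)%R, (d - a)%R]%classic).
  rewrite !lebesgue_measure_itv/= !lte_fin ltrD2r.
  by case: ifP => // _; rewrite -!EFinB; congr EFin; ring.
by apply/seteqP; split => t /=; rewrite !in_itv/= => /andP[? ?]; lra.
Qed.

Lemma measurable_shift m (a : 'rV[R]_m) :
  measurable_fun setT (fun x : 'rV[R]_m => (x + a)%R).
Proof.
apply: measurable_fun_rVP => i; under eq_fun do rewrite mxE.
by apply: measurable_funD => //; exact: measurable_coord_rV.
Qed.

Lemma lebesgue_rV_shift m (a : 'rV[R]_m) (A : set 'rV[R]_m) : measurable A ->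
  leb m [set x | A (x + a)%R] = leb m A.
Proof.
move=> mA.
pose nu := measure_function_pushforward__canonical__measure_function_Measure
    (leb m) (measurable_shift a).
suff h k B : (forall i, measurable (B i)) -> leb m (cube m k%:R) < +oo /\
    leb m [set x | forall i, B i (x 0%R i)] = nu [set x | forall i, B i (x 0%R i)].
  apply/esym/(lebesgue_rV_unique (mu := leb m) (nu := nu)) => // [k|B mB].
    by have [] := h k (fun=> setT) (fun=> measurableT).
  by have [] := h 0%N _ mB.
move=> mB; split.
  rewrite (le_lt_trans (y := leb m (cube m k.+1%:R)))//.
    apply: le_measure; rewrite ?inE; do ?exact: measurable_cube.
    move=> x xk i /=; have := xk i; rewrite /= !in_itv/= -natr1 => /andP[? ?].
    by apply/andP; split; lra.
  by rewrite lebesgue_rV_cube// ltry.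
rewrite lebesgue_rV_box// /nu /= /pushforward.
rewrite (_ : _ @^-1` _ =
    [set x : 'rV[R]_m | forall i, [set t | B i (t + a 0 i)%R] (x 0%R i)]).
  rewrite (@lebesgue_rV_box R m (fun i => [set t | B i (t + a 0 i)%R])).
    by apply: eq_bigr => i _; rewrite lebesgue_measure_shift.
  move=> i; rewrite -[X in measurable X]setTI.
  exact: (measurable_funD (@measurable_id _ _ _) (measurable_cst (a 0%R i))).
by apply/seteqP; split => x /= h i; have := h i; rewrite mxE.
Qed.

End lebesgue_box.
Arguments cube {R} m r _.

(** * Uniqueness of Haar measure *)

Section lebesgue_linear.
Context {R : realType} {m : nat}.
Local Notation V := 'rV[R]_m.
Local Notation leb := (@lebesgue_rV R m).
Local Open Scope ereal_scope.

Lemma measurable_preim d1 d2 (T1 : measurableType d1) (T2 : measurableType d2)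
    (f : T1 -> T2) (A : set T2) :
  measurable_fun setT f -> measurable A -> measurable [set x | A (f x)].
Proof. by move=> mf mA; rewrite -[X in measurable X]setTI; exact: mf. Qed.

Lemma measurable_rVD d1 (T1 : measurableType d1) (f g : T1 -> V) :
  measurable_fun setT f -> measurable_fun setT g ->
  measurable_fun setT (fun x => (f x + g x)%R).
Proof.
move=> mf mg; apply: measurable_fun_rVP => i; under eq_fun do rewrite mxE.
by apply: measurable_funD; apply: (measurableT_comp (measurable_coord_rV i)).
Qed.

Lemma measurable_rVZ d1 (T1 : measurableType d1) (f : T1 -> V) (k : T1 -> R) :
  measurable_fun setT f -> measurable_fun setT k ->
  measurable_fun setT (fun x => (k x *: f x)%R).
Proof.
move=> mf mk; apply: measurable_fun_rVP => i; under eq_fun do rewrite mxE.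
by apply: measurable_funM => //; apply: (measurableT_comp (measurable_coord_rV i)).
Qed.

Lemma measurable_rVN d1 (T1 : measurableType d1) (f : T1 -> V) :
  measurable_fun setT f -> measurable_fun setT (fun x => (- f x)%R).
Proof.
move=> mf; under eq_fun do rewrite -scaleN1r.
exact: (measurable_rVZ mf (measurable_cst _)).
Qed.

Lemma measurable_rVB d1 (T1 : measurableType d1) (f g : T1 -> V) :
  measurable_fun setT f -> measurable_fun setT g ->
  measurable_fun setT (fun x => (f x - g x)%R).
Proof. by move=> mf mg; apply: measurable_rVD => //; exact: measurable_rVN. Qed.

Lemma fubini_section (D : set (V * V)) : measurable D ->
  \int[leb]_x leb [set y | D (x, y)] = \int[leb]_y leb [set x | D (x, y)].
Proof.
move=> mD; have := @fubini_tonelli _ _ _ _ R leb leb (EFin \o \1_D).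
have mf : measurable_fun setT (EFin \o (\1_D : _ -> R)).
  by apply/measurable_EFinP; exact: measurable_indic.
move=> /(_ mf) H; transitivity (\int[leb]_x \int[leb]_y (\1_D (x, y))%:E).
  apply: eq_integral => x _.
  rewrite -[RHS]/(\int[leb]_y (\1_[set y | D (x, y)] y)%:E) integral_indic ?setIT//.
  exact: (measurable_preim (measurable_pair1 x)).
rewrite H => [|z]; last by rewrite lee_fin.
apply: eq_integral => y _.
rewrite -[LHS]/(\int[leb]_x (\1_[set x | D (x, y)] x)%:E) integral_indic ?setIT//.
exact: (measurable_preim (measurable_pair2 y)).
Qed.

(** Uniqueness of Haar measure: unfold one product measure in two ways, using
    only that translations preserve Lebesgue measure. The right inverse S
    turns a translation by y of T x into a translation of x. *)
Lemma lebesgue_rV_haar (T S : V -> V) (A B : set V) :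
  measurable_fun setT T -> (forall x y, T (x + y) = T x + T y)%R ->
  (forall y, T (S y) = y) -> measurable A -> measurable B ->
  leb [set x | A (T x)] * leb B = leb [set x | A (- x)%R] * leb [set x | B (T x)].
Proof.
move=> mT TD TS mA mB.
have mT1 : measurable_fun setT (fun p : V * V => T p.1) by exact: measurableT_comp.
have m1 : measurable [set p : V * V | A (T p.1 - p.2)%R /\ B p.2].
  apply: measurableI.
    exact: (measurable_preim (measurable_rVB mT1 measurable_snd)).
  exact: (measurable_preim measurable_snd).
have m2 : measurable [set p : V * V | A (- p.2)%R /\ B (p.2 + T p.1)%R].
  apply: measurableI.
    exact: (measurable_preim (measurable_rVN measurable_snd)).
  exact: (measurable_preim (measurable_rVD measurable_snd mT1)).
have mTA : measurable [set x | A (T x)] by exact: measurable_preim.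
have mTB : measurable [set x | B (T x)] by exact: measurable_preim.
have mNA : measurable [set x : V | A (- x)%R].
  by apply: (measurable_preim _ mA); apply: measurable_rVN; exact: measurable_id.
have Z (C : set V) (c : \bar R) : measurable C -> 0 <= c ->
    \int[leb]_x (c * (\1_C x)%:E) = c * leb C.
  move=> mC c0; rewrite ge0_integralZl//.
    by rewrite integral_indic// setIT.
  by apply/measurable_EFinP; exact: measurable_indic.
have T0 : T 0%R = 0%R by apply: (addrI (T 0%R)); rewrite -TD !addr0.
have TN x : T (- x)%R = (- T x)%R.
  by apply/eqP; rewrite -addr_eq0 -TD addNr T0.
transitivity (\int[leb]_y leb [set x | A (T x - y)%R /\ B y]).
  rewrite -Z//; apply: eq_integral => y _; rewrite indicE.
  case: (boolP (y \in B)) => [/set_mem By|/negP By].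
    rewrite mule1 -(lebesgue_rV_shift (- S y)%R mTA).
    congr (leb _); apply/seteqP; split => x /=; first by rewrite TD TN TS.
    by rewrite TD TN TS => -[].
  rewrite mule0 [X in leb X](_ : _ = set0) ?measure0// -subset0 => x [_ Ay].
  by apply: By; rewrite inE.
rewrite -(fubini_section m1).
transitivity (\int[leb]_x leb [set y | A (- y)%R /\ B (y + T x)%R]).
  apply: eq_integral => x _.
  rewrite -(lebesgue_rV_shift (T x)).
    congr (leb _); apply/seteqP; split => y /=;
    by rewrite opprD addrCA subrr addr0.
  exact: (measurable_preim (measurable_pair1 x) m1).
rewrite (fubini_section m2) -[RHS]muleC -Z//; apply: eq_integral => y _.
rewrite indicE; case: (boolP (y \in _)) => [/set_mem /= By|/negP By].
  rewrite mule1 -(lebesgue_rV_shift (- S y)%R).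
    congr (leb _); apply/seteqP; split => x /=;
    by rewrite TD TN TS addrCA subrr addr0 // => -[].
  exact: (measurable_preim (measurable_pair2 y) m2).
rewrite mule0 [X in leb X](_ : _ = set0) ?measure0// -subset0 => x [Ay _].
by apply: By; rewrite inE.
Qed.

End lebesgue_linear.

(** * Invariance of Lebesgue measure *)

Section lebesgue_invariance.
Context {R : realType} {m : nat}.
Local Notation V := 'rV[R]_m.
Local Notation leb := (@lebesgue_rV R m).
Implicit Types (A : set V) (v x : V).
Local Open Scope ereal_scope.

Lemma open_lebesgue_gt0 A : open A -> A !=set0 -> 0 < leb A.
Proof.
move=> oA [x Ax].
have /nbhs_ballP[e /= e0 eA] : nbhs x A by exact: open_nbhs_nbhs.
rewrite (lt_le_trans (y := leb [set y | cube m (e / 2) (y + - x)%R]))//.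
  rewrite lebesgue_rV_shift; last exact: measurable_cube.
  rewrite lebesgue_rV_cube ?divr_gt0// lte_fin exprn_gt0//; lra.
apply: le_measure; rewrite ?inE.
- by apply: (measurable_preim (measurable_shift _)); exact: measurable_cube.
- exact: open_measurable_rV.
move=> y h; apply: eA; split => // i j; rewrite /ball/= ord1 distrC.
have := h j; rewrite /= in_itv/= !mxE => /andP[? ?].
by rewrite ltr_norml; apply/andP; split; lra.
Qed.

Lemma eball_lebesgue_lty x (r : R) : leb (eball x r) < +oo.
Proof.
have [r0|r0] := leP r 0%R.
  rewrite (_ : eball x r = set0) ?measure0// -subset0 => y /=.
  by rewrite /eball/=; have := enorm_ge0 (y - x); lra.
rewrite (le_lt_trans (y := leb [set y | cube m r (y + - x)%R]))//.
  apply: le_measure; rewrite ?inE.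
  - by apply: open_measurable_rV; exact: eball_open.
  - by apply: (measurable_preim (measurable_shift _)); exact: measurable_cube.
  move=> y; rewrite /eball /= => yx i; rewrite /= in_itv/= -ler_norml.
  by apply: le_trans (coord_le_enorm _ i) _; exact: ltW.
rewrite lebesgue_rV_shift; last exact: measurable_cube.
by rewrite lebesgue_rV_cube// ltry.
Qed.

Lemma mule_cancel_fin (a b c : \bar R) : 0 < c -> c < +oo ->
  a * c = b * c -> a = b.
Proof.
move=> c0 coo; have cfin : c \is a fin_num by rewrite ge0_fin_numE// ltW.
move=> E; apply: le_anti; apply/andP; split.
  by rewrite -(lee_pmul2r cfin c0) E.
by rewrite -(lee_pmul2r cfin c0) E.
Qed.

(** The cube is symmetric, so it does not see the sign left over by the Haar
    argument; each further map only has to be tested on one convenient set. *)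
Lemma lebesgue_rVN A : measurable A -> leb [set x | A (- x)%R] = leb A.
Proof.
move=> mA.
have := @lebesgue_rV_haar R m id id A (cube m 1) (@measurable_id _ _ _)
  (fun _ _ => erefl) (fun=> erefl) mA (measurable_cube 1).
rewrite lebesgue_rV_cube// => /mule_cancel_fin ->//; last exact: ltry.
Qed.

Lemma lebesgue_rV_linear (T S : V -> V) A B : measurable_fun setT T ->
  (forall x y, T (x + y) = T x + T y)%R -> (forall y, T (S y) = y) ->
  measurable A -> measurable B ->
  leb [set x | A (T x)] * leb B = leb A * leb [set x | B (T x)].
Proof.
by move=> mT TD TS mA mB; rewrite (lebesgue_rV_haar mT TD TS)// lebesgue_rVN.
Qed.

Lemma measurable_scale (t : R) : measurable_fun setT (fun x : V => t *: x)%R.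
Proof.
exact: (measurable_rVZ (@measurable_id _ _ _) (measurable_cst t)).
Qed.

Lemma lebesgue_rV_scale (t : R) A : (0 < t)%R -> measurable A ->
  leb [set x | A (t *: x)%R] = (t ^- m)%:E * leb A.
Proof.
move=> t0 mA.
have t0' : t != 0%R by rewrite gt_eqF.
have := @lebesgue_rV_linear (fun x => t *: x)%R (fun x => t^-1 *: x)%R A (cube m 1)
  (measurable_scale t) (scalerDr t) (scalerKV t0') mA (measurable_cube 1).
rewrite (_ : [set x | cube m 1 (t *: x)%R] = cube m t^-1); last first.
  apply/seteqP; split => x h i; have := h i; rewrite /= !in_itv/= !mxE -!ler_norml.
    by rewrite normrM gtr0_norm// mulrC -ler_pdivlMr// mul1r.
  by rewrite normrM gtr0_norm// mulrC -ler_pdivlMr// mul1r.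
rewrite !lebesgue_rV_cube ?invr_gt0// => E.
apply: (@mule_cancel_fin _ _ ((2 * 1) ^+ m)%:E).
- by rewrite lte_fin exprn_gt0// mulr1.
- exact: ltry.
rewrite E [RHS]muleAC [RHS]muleC -EFinM -exprVn -exprMn.
by rewrite mulr1 (mulrC 2%R).
Qed.

Lemma reflectionE v b x :
  reflection v b x = (x - (2 * dotv x v) *: v + (2 * b) *: v)%R.
Proof. by apply/rowP => i; rewrite /reflection !mxE; ring. Qed.

Lemma measurable_reflection v b : measurable_fun setT (reflection v b).
Proof.
apply: (measurable_rVB (@measurable_id _ _ _)).
apply: (measurable_rVZ (measurable_cst v)).
apply: measurable_funM => //; apply: measurable_funB => //.
exact: measurable_dotv.
Qed.

Lemma dotv_reflection v b x : esphere v ->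
  dotv (reflection v b x) v = (2 * b - dotv x v)%R.
Proof.
by rewrite /esphere/= => v1; rewrite /reflection !dotvE -(sqr_enorm v) v1; ring.
Qed.

Lemma reflectionK v b : esphere v -> involutive (reflection v b).
Proof.
move=> v1 x; rewrite {1}/reflection dotv_reflection//.
by apply/rowP => i; rewrite /reflection !mxE; ring.
Qed.

Lemma enorm_reflection v b x y : esphere v ->
  enorm (reflection v b x - reflection v b y) = enorm (x - y).
Proof.
rewrite /esphere/= => v1.
have -> : (reflection v b x - reflection v b y =
    (x - y) - (2 * (dotv (x - y) v)) *: v)%R.
  by apply/rowP => i; rewrite /reflection dotvBl !mxE; ring.
rewrite /enorm; congr Num.sqrt; move: (x - y)%R => w.
rewrite !dotvE (dotvC v w) -(sqr_enorm v) v1; ring.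
Qed.

(** The linear part of a reflection maps the unit ball onto itself, which fixes
    the Haar constant to be 1. *)
Lemma lebesgue_rV_reflection v b A : esphere v -> measurable A ->
  leb [set x | A (reflection v b x)] = leb A.
Proof.
move=> v1 mA; pose L := reflection v 0.
have LD x y : (L (x + y) = L x + L y)%R.
  by rewrite /L; apply/rowP => i; rewrite /reflection dotvDl !mxE; ring.
pose A' := [set x : V | A (x + (2 * b) *: v)%R].
have mA' : measurable A' by exact: (measurable_preim (measurable_shift _)).
rewrite (_ : [set x | _] = [set x | A' (L x)]); last first.
  by apply/seteqP; split => x; rewrite /A' /L /= !reflectionE mulr0 scale0r addr0.
have mB : measurable (eball (0 : V) 1).
  by apply: open_measurable_rV; exact: eball_open.
have := @lebesgue_rV_linear L L A' _ (measurable_reflection v 0) LD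
  (reflectionK 0%R v1) mA' mB.
rewrite (_ : [set x | eball 0%R 1%R (L x)] = eball 0%R 1%R); last first.
  have L0 : (L 0 = 0)%R by apply: (addrI (L 0%R)); rewrite -LD !addr0.
  have LB x : enorm (L x - 0)%R = enorm (x - 0)%R.
    by rewrite -{1}L0 enorm_reflection.
  by apply/seteqP; split => x; rewrite /eball /= LB.
move=> /mule_cancel_fin ->; first by rewrite lebesgue_rV_shift.
- apply: open_lebesgue_gt0; first exact: eball_open.
  by exists 0%R; rewrite /eball /= subrr enorm0.
- exact: eball_lebesgue_lty.
Qed.

Lemma ge0_integral_preserving (T : V -> V) (D : set V) (f : V -> \bar R) :
  measurable_fun setT T ->
  (forall A, measurable A -> leb [set x | A (T x)] = leb A) ->
  measurable D -> measurable_fun D f -> (forall x, D x -> 0 <= f x) ->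
  \int[leb]_(x in D) f x = \int[leb]_(x in [set x | D (T x)]) f (T x).
Proof.
move=> mT TE mD mf f0.
rewrite -(ge0_integral_pushforward mT)//; last by move=> x /[!inE]; exact: f0.
apply: (eq_measure_integral
  (measure_function_pushforward__canonical__measure_function_Measure leb mT)) => A mA _.
exact/esym/TE.
Qed.

Lemma rV_set1_box x : [set x] = [set y | forall i, [set x 0%R i] (y 0%R i)].
Proof.
by apply/seteqP; split => [y -> //|y h]; apply/rowP => i; exact: h.
Qed.

Lemma measurable_rV_set1 x : measurable [set x].
Proof. by rewrite rV_set1_box; exact: (@measurable_box R m (fun i => [set x 0%R i])). Qed.

Lemma lebesgue_rV_set1 (hm : (0 < m)%N) x : leb [set x] = 0.
Proof.
rewrite rV_set1_box (@lebesgue_rV_box R m (fun i => [set x 0%R i]))//.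
by rewrite (bigD1 (Ordinal hm))//= lebesgue_measure_set1 mul0e.
Qed.

End lebesgue_invariance.

(** * Image measures with a density *)

Lemma measurable_lt {R : realType} d (T : measurableType d) (f g : T -> R) :
  measurable_fun setT f -> measurable_fun setT g ->
  measurable [set x | f x < g x].
Proof.
move=> mf mg; rewrite -preimage_true -[X in measurable X]setTI.
by apply: (measurable_fun_ltr mf mg).
Qed.

Section density.
Context {R : realType}.
Variable g : R -> R.
Hypotheses (mg : measurable_fun setT g) (g0 : forall s, 0 <= g s).
Local Open Scope ereal_scope.

Definition density_measure (A : set R) : \bar R :=
  \int[lebesgue_measure]_(s in A) (g s)%:E.

Let density0 : density_measure set0 = 0.
Proof. exact: integral_set0. Qed.

Let density_ge0 A : 0 <= density_measure A.
Proof. by apply: integral_ge0 => s _; rewrite lee_fin. Qed.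

Let density_sigma_additive : semi_sigma_additive density_measure.
Proof.
move=> F mF tF mUF; rewrite /density_measure; apply: cvg_toP.
  apply: ereal_nondecreasing_is_cvgn => k n kn.
  by apply: lee_sum_nneg_natr => // i _ _; exact: density_ge0.
rewrite ge0_integral_bigcup//=.
- by apply/measurable_funTS/measurable_EFinP.
- by move=> x _; rewrite lee_fin.
Qed.

HB.instance Definition _ := isMeasure.Build _ _ _
  density_measure density0 density_ge0 density_sigma_additive.

Definition density : {measure set R -> \bar R} := density_measure.

End density.

(** Rays need no control of single radii: the measure of a sphere never has to
    be computed. *)
Lemma measure_unique_rays {R : realType} (mu nu : {measure set R -> \bar R}) :
  (forall b, mu `]-oo, b[%classic < +oo)%E ->
  (forall b, mu `]-oo, b[%classic = nu `]-oo, b[%classic) ->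
  forall A, measurable A -> mu A = nu A.
Proof.
move=> fin munu A mA.
apply: (measure_unique (@RGenInftyO.G R) (fun n => `]-oo, n%:R[%classic)) => //.
- exact: RGenInftyO.measurableE.
- move=> _ _ [x ->] [y ->]; exists (Order.min x y); apply/seteqP.
  split => z /=; rewrite !in_itv/= lt_min; first by move=> [-> ->].
  by move=> /andP[].
- by move=> i; exists i%:R.
- apply/seteqP; split => // x _; exists (Num.bound x) => //=.
  rewrite in_itv/=; have [x0|x0] := leP 0 x; first exact: archi_boundP.
  by apply: lt_le_trans x0 _.
- by move=> _ [b ->].
Qed.

(** Layer cake: both sides integrate over u the measure of the part where f
    exceeds u. *)
Lemma ge0_integral_pushforward_density {R : realType} d (T : measurableType d)
    (mu : {sigma_finite_measure set T -> \bar R}) (K : set T) (q : T -> R)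
    (g f : R -> R) :
  measurable K -> measurable_fun setT q ->
  measurable_fun setT g -> (forall s, 0 <= g s) ->
  measurable_fun setT f -> (forall s, 0 <= f s) ->
  (forall A, measurable A ->
    mu (K `&` q @^-1` A) = \int[lebesgue_measure]_(s in A) (g s)%:E)%E ->
  (\int[mu]_(w in K) (f (q w))%:E =
   \int[lebesgue_measure]_s (f s * g s)%:E)%E.
Proof.
move=> mK mq mg g0 mf f0 E.
pose lam := @lebesgue_measure R.
have layer s : (f s)%:E = (\int[lam]_u (\1_(`]0%R, f s[%classic) u)%:E)%E.
  rewrite integral_indic//= setIT /lam lebesgue_measure_itv/= lte_fin.
  case: ltP => [_|fs0]; first by rewrite sube0.
  by congr EFin; apply/le_anti; rewrite fs0 f0.
have mind d' (T' : measurableType d') (h : T' -> R) :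
    measurable_fun setT h ->
    measurable_fun setT (fun p : T' * R => (\1_(`]0%R, h p.1[%classic) p.2 : R)).
  move=> mh; rewrite (_ : (fun p => _) = \1_[set p : T' * R | 0 < p.2 < h p.1]).
    apply: measurable_indic; rewrite [X in measurable X](_ : _ =
      [set p | 0 < p.2] `&` [set p | p.2 < h p.1]); last first.
      by apply/seteqP; split => p /= => [/andP[]|[-> ->]].
    apply: measurableI.
      by apply: (@measurable_lt R _ _ (fun=> 0) snd).
    apply: (@measurable_lt R _ _ snd (h \o fst)) => //.
    exact: (measurableT_comp mh measurable_fst).
  by apply/funext => p; rewrite !indicE.
pose L (u : R) := [set s | 0 < u < f s].
have mL u : measurable (L u).
  rewrite (_ : L u = if 0 < u then [set s | u < f s] else set0).
    by case: ifP => // _; apply: (@measurable_lt R _ _ (fun=> u) f).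
  by apply/seteqP; rewrite /L; case: (0 < u); split => s /=.
transitivity (\int[mu]_w \int[lam]_u
    (\1_K w * \1_(`]0%R, f (q w)[%classic) u)%:E)%E.
  rewrite integral_mkcond; apply: eq_integral => w _.
  rewrite patchE; case: ifPn => wK.
    by rewrite layer; apply: eq_integral => u _; rewrite (indicE _ K) wK mul1r.
  rewrite -[LHS](integral0 lam setT); apply: eq_integral => u _.
  by rewrite (indicE _ K) (negbTE wK) mul0r.
rewrite (fubini_tonelli (m1 := mu) (m2 := lam)
  (fun p => (\1_K p.1 * \1_(`]0%R, f (q p.1)[%classic) p.2)%:E)); last 2 first.
- apply/measurable_EFinP; apply: measurable_funM.
    exact: (measurableT_comp (measurable_indic mK) measurable_fst).
  exact: (mind _ _ (f \o q) (measurableT_comp mf mq)).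
- by move=> p; rewrite lee_fin mulr_ge0.
transitivity (\int[lam]_u \int[lam]_s (\1_(`]0%R, f s[%classic) u * g s)%:E)%E.
  apply: eq_integral => u _.
  transitivity (mu (K `&` q @^-1` L u)).
    rewrite -[X in mu X]setIT -integral_indic//; last first.
      by apply: measurableI => //; rewrite -[X in measurable X]setTI; exact: mq.
    apply: eq_integral => w _; congr EFin.
    by rewrite indicI.
  rewrite E// integral_mkcond; apply: eq_integral => s _.
  rewrite patchE indicE.
  by rewrite -[u \in _]/(s \in L u); case: ifP => _; rewrite ?mul1r ?mul0r.
rewrite -(fubini_tonelli (m1 := lam) (m2 := lam)
  (fun p => (\1_(`]0%R, f p.1[%classic) p.2 * g p.1)%:E)); last 2 first.
- apply/measurable_EFinP; apply: measurable_funM; first exact: (mind _ _ f mf).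
  exact: (measurableT_comp mg measurable_fst).
- by move=> p; rewrite lee_fin mulr_ge0.
apply: eq_integral => s _; rewrite EFinM layer.
transitivity (\int[lam]_u ((g s)%:E * (\1_(`]0%R, f s[%classic) u)%:E))%E.
  by apply: eq_integral => u _; rewrite -EFinM mulrC.
rewrite ge0_integralZl//; first by rewrite muleC.
- by apply/measurable_EFinP; exact: measurable_indic.
- by rewrite lee_fin.
Qed.

(** * Primitives of powers *)

Section power_integral.
Context {R : realType}.
Implicit Types (x y s p : R).

Definition power_primitive p s : R := if p == 0 then ln s else s `^ p / p.

Lemma is_derive_power_primitive p s : 0 < s ->
  is_derive s 1 (power_primitive p) (s `^ (p - 1)).
Proof.
move=> s0; rewrite /power_primitive; case: eqVneq => [->|p0].
  rewrite sub0r powRN powRr1 ?ltW//; exact: is_derive1_ln.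
rewrite [X in is_derive _ _ X](_ : _ = p^-1 *: (fun s => s `^ p)); last first.
  by apply/funext => t; rewrite mulrC.
have dp := is_derive1_powR p s0.
apply: is_derive_eq.
by rewrite /GRing.scale /= mulrA mulVf ?mul1r.
Qed.

Lemma continuous_powR p s : 0 < s -> {for s, continuous (fun t => t `^ p)}.
Proof.
move=> s0; apply: differentiable_continuous; apply/derivable1_diffP.
exact: (@ex_derive _ _ _ _ _ _ _ (is_derive1_powR p s0)).
Qed.

Lemma powR_right0 p : 0 <= p -> t `^ p @[t --> 0^'+] --> 0 `^ p.
Proof.
rewrite le_eqVlt => /predU1P[<-|p0].
  by rewrite (eq_cvg _ _ (fun t => powRr0 t)) powRr0; exact: cvg_cst.
by rewrite powR0 ?gt_eqF//; exact: powR_cvg0.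
Qed.

Lemma within_continuous_powR p y : 0 <= p -> 0 < y ->
  {within `[0, y], continuous (fun t => t `^ p)}.
Proof.
move=> p0 y0; apply/continuous_within_itvP => //; split.
- by move=> s; rewrite in_itv/= => /andP[s0 _]; exact: continuous_powR.
- exact: powR_right0.
- by apply: cvg_at_left_filter; exact: continuous_powR.
Qed.

Lemma integral_powR p x y : 0 < x -> x < y ->
  (\int[lebesgue_measure]_(s in `[x, y[) (s `^ (p - 1))%:E =
   (power_primitive p y - power_primitive p x)%:E)%E.
Proof.
move=> x0 xy.
have cF s : 0 < s -> {for s, continuous (power_primitive p)}.
  move=> s0; apply: differentiable_continuous; apply/derivable1_diffP.
  exact: (@ex_derive _ _ _ _ _ _ _ (is_derive_power_primitive p s0)).
rewrite integral_itv_bndo_bndc; last first.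
  by apply/measurable_EFinP/measurable_funTS; exact: measurable_powR.
rewrite (@continuous_FTC2 _ _ (power_primitive p))//.
- apply: continuous_in_subspaceT => s; rewrite inE/= in_itv/= => /andP[xs _].
  by apply: continuous_powR; lra.
- split.
  + move=> s; rewrite in_itv/= => /andP[xs _].
    apply: (@ex_derive _ _ _ _ _ _ _ (is_derive_power_primitive p _)); lra.
  + by apply: cvg_at_right_filter; exact: cF.
  + by apply: cvg_at_left_filter; apply: cF; lra.
- move=> s; rewrite in_itv/= => /andP[xs _]; rewrite derive1E.
  apply: (@derive_val _ _ _ _ _ _ _ (is_derive_power_primitive p _)); lra.
Qed.

Lemma integral0_powR p y : 1 <= p -> 0 < y ->
  (\int[lebesgue_measure]_(s in `[0%R, y[) (s `^ (p - 1))%:E = (y `^ p / p)%:E)%E.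
Proof.
move=> p1 y0; have p0 : 0 < p by lra.
have E : power_primitive p = fun s => s `^ p / p.
  by apply/funext => s; rewrite /power_primitive gt_eqF.
rewrite integral_itv_bndo_bndc; last first.
  by apply/measurable_EFinP/measurable_funTS; exact: measurable_powR.
rewrite (@continuous_FTC2 _ _ (power_primitive p))//.
- by rewrite E powR0 ?gt_eqF// mul0r sube0.
- by apply: within_continuous_powR => //; lra.
- split.
  + move=> s; rewrite in_itv/= => /andP[s0 _].
    exact: (@ex_derive _ _ _ _ _ _ _ (is_derive_power_primitive p s0)).
  + rewrite E; apply: cvgMl; apply: powR_right0; exact: ltW.
  + rewrite E; apply: cvgMl; apply: cvg_at_left_filter; exact: continuous_powR.
- move=> s; rewrite in_itv/= => /andP[s0 _]; rewrite derive1E.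
  exact: (@derive_val _ _ _ _ _ _ _ (is_derive_power_primitive p s0)).
Qed.

End power_integral.

(** * Polar coordinates on cones *)

Section polar.
Context {R : realType} {m : nat}.
Hypothesis m2 : (2 <= m)%N.
Local Notation V := 'rV[R]_m.
Local Notation leb := (@lebesgue_rV R m).

Definition is_cone (K : set V) := forall (t : R) w, 0 < t -> K w -> K (t *: w).

(** For a cone, m times this number is the area that K cuts out of the unit
    sphere. *)
Definition cone_volume (K : set V) : R := fine (leb (K `&` eball 0 1)).

Lemma eball0E (r : R) : 0 <= r -> eball (0 : V) r = [set w | dotv w w < r ^+ 2].
Proof.
move=> r0; apply/seteqP; split => w; rewrite /eball /= subr0 -sqr_enorm;
  by rewrite ltr_pXn2r// nnegrE enorm_ge0.
Qed.

Lemma measurable_eball z (r : R) : measurable (eball z r : set V).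
Proof. by apply: open_measurable_rV; exact: eball_open. Qed.

Variable K : set V.
Hypotheses (mK : measurable K) (coneK : is_cone K).

Lemma cone_volumeE : leb (K `&` eball 0 1) = (cone_volume K)%:E.
Proof.
rewrite /cone_volume fineK// ge0_fin_numE//.
apply: le_lt_trans (eball_lebesgue_lty 0 1).
apply: le_measure; rewrite ?inE; last exact: subIsetr.
  by apply: measurableI => //; exact: measurable_eball.
exact: measurable_eball.
Qed.

Lemma cone_volume_ge0 : 0 <= cone_volume K.
Proof. exact: fine_ge0. Qed.

Lemma is_coneE (t : R) w : 0 < t -> K (t *: w) = K w.
Proof.
move=> t0; apply/propext; split; last exact: coneK.
by move=> /(coneK (t := t^-1)); rewrite invr_gt0 scalerA mulVf ?gt_eqF// scale1r; exact.
Qed.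

Lemma lebesgue_cone_eball (r : R) : 0 < r ->
  leb (K `&` eball 0 r) = (r ^+ m * cone_volume K)%:E.
Proof.
move=> r0; rewrite EFinM -cone_volumeE.
have r0' : 0 < r^-1 by rewrite invr_gt0.
rewrite -{2}(invrK r) exprVn -lebesgue_rV_scale//; last first.
  by apply: measurableI => //; exact: measurable_eball.
congr (leb _); apply/seteqP; split => w; rewrite /eball /= !subr0 is_coneE//;
  by rewrite enormZ gtr0_norm// mulrC ltr_pdivrMr// mul1r.
Qed.

(** The derivative, with respect to s, of the volume s^(m/2) cone_volume K of
    the points of K with squared norm below s. *)
Definition radial_density (s : R) : R :=
  if 0 < s then m%:R / 2 * cone_volume K * s `^ (m%:R / 2 - 1) else 0.

Lemma radial_density_ge0 s : 0 <= radial_density s.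
Proof.
rewrite /radial_density; case: ifP => // _.
by rewrite !mulr_ge0 ?powR_ge0 ?cone_volume_ge0// divr_ge0.
Qed.

Lemma measurable_radial_density : measurable_fun setT radial_density.
Proof.
apply: measurable_fun_ifT => //.
  by apply: measurable_fun_ltr.
by apply: measurable_funM => //; exact: measurable_powR.
Qed.

Lemma radial_density_ray (b : R) :
  (leb (K `&` (fun w => dotv w w) @^-1` `]-oo, b[%classic) =
   \int[lebesgue_measure]_(s in `]-oo, b[) (radial_density s)%:E)%E.
Proof.
have m0 : 1 <= m%:R / 2 :> R by rewrite ler_pdivlMr// mul1r ler_nat.
have [b0|b0] := leP b 0.
  rewrite [X in leb X](_ : _ = set0) ?measure0; last first.
    rewrite -subset0 => w [_] /=; rewrite in_itv/=.
    by have := dotvv_ge0 w; lra.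
  rewrite integral0_eq// => s; rewrite /= in_itv/= /radial_density => sb.
  by rewrite ifF//; apply/negbTE; rewrite -leNgt; lra.
transitivity (\int[lebesgue_measure]_(s in `[0%R, b[)
    ((m%:R / 2 * cone_volume K)%:E * (s `^ (m%:R / 2 - 1))%:E))%E.
  rewrite ge0_integralZl//.
  - rewrite integral0_powR//.
    rewrite [X in leb X](_ : _ = K `&` eball 0 (Num.sqrt b)); last first.
      by rewrite eball0E ?sqrtr_ge0// sqr_sqrtr ?ltW.
    rewrite lebesgue_cone_eball ?sqrtr_gt0// -EFinM; congr EFin.
    have -> : b `^ (m%:R / 2) = Num.sqrt b ^+ m.
      by rewrite mulrC powRrM powR12_sqrt ?ltW// powR_mulrn// sqrtr_ge0.
    by field; rewrite pnatr_eq0 -lt0n; exact: leq_trans m2.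
  - by apply/measurable_EFinP/measurable_funTS; exact: measurable_powR.
  - by move=> s _; rewrite lee_fin powR_ge0.
  - by rewrite lee_fin mulr_ge0 ?cone_volume_ge0// divr_ge0.
rewrite -integral_itv_obnd_cbnd; last first.
  apply: measurable_funeM.
  by apply/measurable_EFinP/measurable_funTS; exact: measurable_powR.
rewrite integral_mkcond [RHS]integral_mkcond; apply: eq_integral => s _.
rewrite !patchE !mem_setE !in_itv/= /radial_density.
by case: ltP => //= s0; case: ifP.
Qed.

Lemma radial_pushforward A : measurable A ->
  (leb (K `&` (fun w => dotv w w) @^-1` A) =
   \int[lebesgue_measure]_(s in A) (radial_density s)%:E)%E.
Proof.
move=> mA.
pose mu : {measure set R -> \bar R} :=
  measure_function_pushforward__canonical__measure_function_Measure
    (mrestr leb mK) (@measurable_dotvv R m).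
pose nu := density measurable_radial_density radial_density_ge0.
have muE B : mu B = leb (K `&` (fun w => dotv w w) @^-1` B) by rewrite setIC.
rewrite -muE; apply: (@measure_unique_rays _ mu nu) => // b; rewrite muE.
  rewrite (le_lt_trans (y := leb (eball 0 (Num.sqrt b + 1))))//.
    apply: le_measure; rewrite ?inE.
    - apply: measurableI => //; rewrite -[X in measurable X]setTI.
      exact: measurable_dotvv.
    - exact: measurable_eball.
    rewrite eball0E ?addr_ge0 ?sqrtr_ge0// => w [_] /=; rewrite in_itv/= => wb.
    have b0 : 0 <= b by have := dotvv_ge0 w; lra.
    have := sqr_sqrtr b0; have := sqrtr_ge0 b; nra.
  exact: eball_lebesgue_lty.
exact: radial_density_ray.
Qed.

(** Integration in polar coordinates. The squared radius serves as variable
    because its density times a decaying exponential is the integrand of the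
    Gamma function. *)
Lemma integral_cone_radial (f : R -> R) :
  measurable_fun setT f -> (forall s, 0 <= f s) ->
  (\int[leb]_(w in K) (f (dotv w w))%:E =
   \int[lebesgue_measure]_s (f s * radial_density s)%:E)%E.
Proof.
move=> mf f0; apply: ge0_integral_pushforward_density => //.
- exact: measurable_dotvv.
- exact: measurable_radial_density.
- exact: radial_density_ge0.
- exact: radial_pushforward.
Qed.

End polar.

(** * Shells and the area of the sphere *)

Section shells.
Context {R : realType} {m : nat}.
Hypothesis m2 : (2 <= m)%N.
Local Notation V := 'rV[R]_m.
Local Notation leb := (@lebesgue_rV R m).

Lemma enorm_powR (w : V) (p : R) : enorm w `^ p = dotv w w `^ (p / 2).
Proof. by rewrite mulrC powRrM powR12_sqrt ?dotvv_ge0. Qed.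

Lemma power_primitive_sqr (p b : R) : 0 < b ->
  power_primitive (p / 2) (b ^+ 2) = 2 * power_primitive p b.
Proof.
move=> b0; have b2 : b ^+ 2 = b `^ 2 by rewrite powR_mulrn// ltW.
rewrite /power_primitive mulf_eq0 invr_eq0 pnatr_eq0 orbF.
case: eqVneq => [_|p0]; first by rewrite b2 ln_powR.
rewrite b2 -powRrM (_ : 2 * (p / 2) = p); first by field.
by field.
Qed.

Definition shell (a b : R) : set V := [set w | a <= enorm w < b].

Lemma measurable_shell (a b : R) : measurable (shell a b).
Proof.
rewrite (_ : shell a b = eball 0 b `\` eball 0 a); last first.
  apply/seteqP; split => w; rewrite /shell /eball /= !subr0.
    by move=> /andP[aw wb]; split => //; apply/negP; rewrite -leNgt.
  by move=> [wb /negP]; rewrite -leNgt => aw; apply/andP.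
by apply: measurableD; exact: measurable_eball.
Qed.

Lemma integral_cone_shell (K : set V) (alpha a b : R) :
  measurable K -> is_cone K -> 0 < a -> a < b ->
  (\int[leb]_(w in K `&` shell a b) (enorm w `^ (alpha - m%:R))%:E =
   (m%:R * cone_volume K * (power_primitive alpha b - power_primitive alpha a))%:E)%E.
Proof.
move=> mK coneK a0 ab; have b0 : 0 < b by lra.
pose f (s : R) := \1_(`[a ^+ 2, b ^+ 2[%classic) s * s `^ ((alpha - m%:R) / 2).
have mf : measurable_fun setT f.
  by apply: measurable_funM; [exact: measurable_indic|exact: measurable_powR].
have f0 s : 0 <= f s by rewrite mulr_ge0 ?powR_ge0.
transitivity (\int[leb]_(w in K) (f (dotv w w))%:E)%E.
  rewrite integral_mkcondr; apply: eq_integral => w _.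
  rewrite patchE /f -enorm_powR indicE.
  have -> : (dotv w w \in `[a ^+ 2, b ^+ 2[%classic) = (w \in shell a b).
    apply/idP/idP; rewrite !inE /shell /= in_itv/= -sqr_enorm;
    by rewrite ler_pXn2r ?ltr_pXn2r// ?nnegrE ?enorm_ge0 ?ltW.
  by case: ifP => _; rewrite ?mul1r ?mul0r.
rewrite (integral_cone_radial m2 mK coneK mf f0).
transitivity (\int[lebesgue_measure]_(s in `[(a ^+ 2)%R, (b ^+ 2)%R[)
    ((m%:R / 2 * cone_volume K)%:E * (s `^ (alpha / 2 - 1))%:E))%E.
  rewrite [RHS]integral_mkcond; apply: eq_integral => s _.
  rewrite patchE /f indicE; case: ifPn => [|_]; last by rewrite !mul0r.
  rewrite inE /= in_itv/= => /andP[as_ sb].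
  have s0 : 0 < s by apply: lt_le_trans as_; rewrite exprn_gt0.
  rewrite mul1r /radial_density s0 -EFinM mulrCA; congr (_ * _)%:E.
  rewrite -powRD; last by rewrite (gt_eqF s0) implybT.
  by congr (_ `^ _); field.
rewrite ge0_integralZl//.
- rewrite integral_powR ?exprn_gt0 ?ltr_pXn2r ?nnegrE ?ltW//.
  by rewrite !power_primitive_sqr// -EFinM; congr EFin; field.
- by apply/measurable_EFinP/measurable_funTS; exact: measurable_powR.
- by move=> s _; rewrite lee_fin powR_ge0.
- by rewrite lee_fin mulr_ge0 ?cone_volume_ge0// divr_ge0.
Qed.

Lemma cone_volume_gt0 (K O : set V) : measurable K -> open O -> O !=set0 ->
  O `<=` K `&` eball 0 1 -> 0 < cone_volume K.
Proof.
move=> mK oO O0 OK; rewrite -lte_fin -cone_volumeE//.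
apply: lt_le_trans (open_lebesgue_gt0 oO O0) _.
apply: le_measure; rewrite ?inE//; first exact: open_measurable_rV.
by apply: measurableI => //; exact: measurable_eball.
Qed.

End shells.

Lemma integral_rV_gauss {R : realType} (n : nat) :
  (\int[@lebesgue_rV R n]_x (expR (- dotv x x))%:E = (Num.sqrt pi ^+ n)%:E)%E.
Proof.
have mE k : measurable_fun setT (fun x : 'rV[R]_k => (expR (- dotv x x))%:E).
  apply/measurable_EFinP; apply: (measurableT_comp (@measurable_expR R)).
  by apply: measurable_funN; exact: measurable_dotvv.
elim: n => [|n IH].
  rewrite (eq_integral (cst 1%E)) => [|x _]; last first.
    by rewrite /dotv big_ord0 oppr0 expR0.
  by rewrite integral_cst// mul1e /= diracT.
rewrite [LHS](ge0_integral_pushforward (@measurable_rV_cons R n)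
  (lebesgue_measure \x (@lebesgue_rV R n))%E measurableT (mE n.+1)); last first.
  by move=> x _; rewrite lee_fin expR_ge0.
rewrite preimage_setT.
have dE p : dotv (@rV_cons R n p) (rV_cons p) = p.1 ^+ 2 + dotv p.2 p.2.
  rewrite /dotv big_ord_recl !mxE unlift_none -expr2; congr (_ + _).
  by apply: eq_bigr => i _; rewrite !mxE liftK.
rewrite fubini_tonelli1.
- transitivity (\int[lebesgue_measure]_x
      ((Num.sqrt pi ^+ n)%:E * (@gauss_fun R x)%:E))%E.
    apply: eq_integral => x _; rewrite -IH muleC -ge0_integralZl//.
    + by apply: eq_integral => y _; rewrite /= dE opprD expRD EFinM.
    + exact: mE.
    + by rewrite lee_fin gauss_fun_ge0.
  rewrite ge0_integralZl//.
  + by rewrite integralT_gauss -EFinM exprSr.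
  + by apply/measurable_EFinP; exact: measurable_gauss_fun.
  + by move=> x _; rewrite lee_fin gauss_fun_ge0.
- exact: (measurableT_comp (mE n.+1) (@measurable_rV_cons R n)).
- by move=> p; rewrite /= lee_fin expR_ge0.
Qed.

(** Both constants are read off the Gaussian integral: by Fubini it is a power
    of pi, in polar coordinates it is a Gamma integral times the volume. *)
Lemma sphere_area_volume {R : realType} (m : nat) : (2 <= m)%N ->
  sphere_area m = m%:R * cone_volume [set: 'rV[R]_m].
Proof.
move=> m2.
have c0 : 0 < cone_volume [set: 'rV[R]_m].
  apply: (@cone_volume_gt0 _ _ _ (eball 0 1)) => //; first exact: eball_open.
  by exists 0; rewrite /eball /= subrr enorm0.
pose k : R := m%:R / 2 * cone_volume [set: 'rV[R]_m].
have k0 : 0 < k by rewrite mulr_gt0// divr_gt0// ltr0n; exact: leq_trans m2.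
pose h (t : R) := t `^ (m%:R / 2 - 1) * expR (- t).
have mh : measurable_fun setT h.
  apply: measurable_funM; first exact: measurable_powR.
  by apply: (measurableT_comp (@measurable_expR R)).
have E : ((Num.sqrt pi ^+ m)%:E = k%:E *
    \int[lebesgue_measure]_(t in `]0%R, +oo[) (h t)%:E)%E.
  rewrite -integral_rV_gauss.
  rewrite (integral_cone_radial m2 measurableT _ (f := fun s => expR (- s)))//.
  - rewrite -ge0_integralZl//; last 3 first.
    + by apply/measurable_EFinP/measurable_funTS.
    + by move=> t _; rewrite lee_fin mulr_ge0 ?powR_ge0 ?expR_ge0.
    + by rewrite lee_fin ltW.
    rewrite [RHS]integral_mkcond; apply: eq_integral => s _.
    rewrite patchE mem_setE in_itv/= andbT /radial_density /h /k.
    by case: ifP => _; rewrite -?EFinM ?mulr0//; congr EFin; ring.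
  - by apply: (measurableT_comp (@measurable_expR R)).
have G : (\int[lebesgue_measure]_(t in `]0%R, +oo[) (h t)%:E)%E = (Gamma (m%:R / 2 : R))%:E.
  rewrite /Gamma /Rintegral fineK// ge0_fin_numE; last first.
    by apply: integral_ge0 => t _; rewrite lee_fin mulr_ge0 ?powR_ge0 ?expR_ge0.
  rewrite ltey; apply/eqP => oo; move: E; rewrite /h oo.
  by rewrite gt0_muley// lte_fin.
move: E; rewrite G -EFinM => -[E].
have p0 : 0 < Num.sqrt pi ^+ m :> R by rewrite exprn_gt0// sqrtr_gt0 pi_gt0.
have G0 : Gamma (m%:R / 2) != 0 :> R.
  by apply/eqP => G0; move: p0; rewrite E G0 mulr0 ltxx.
have piE : pi `^ (m%:R / 2) = Num.sqrt pi ^+ m :> R.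
  by rewrite (mulrC m%:R) powRrM powR12_sqrt ?pi_ge0// powR_mulrn// sqrtr_ge0.
by rewrite /sphere_area piE E /k; field.
Qed.

(** * Lower semicontinuity of the defect *)

Section lower_semicontinuity.
Context {R : realType}.

(** The sets of points of K that do no worse than a given point of K form a
    filter base, and lower semicontinuity forbids a cluster point of it to be
    worse than any point of K. *)
Lemma lsc_compact_min (T : topologicalType) (W : T -> \bar R) (K : set T) :
  (forall x, 0 <= W x)%E ->
  (forall x (a : R), (a%:E < W x)%E -> \forall y \near x, (a%:E < W y)%E) ->
  compact K -> K !=set0 -> exists2 x, K x & forall y, K y -> (W x <= W y)%E.
Proof.
move=> W0 lsc cK [k Kk].
pose F := filter_from K (fun y => K `&` [set z | W z <= W y]%E).
have FF : ProperFilter F.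
  apply: filter_from_proper => [|y Ky]; last by exists y; split => /=.
  apply: filter_from_filter => [|y z Ky Kz]; first by exists k.
  have [yz|zy] := leP (W y) (W z).
    by exists y => // t [Kt /= ty]; split; split => //=; exact: le_trans yz.
  by exists z => // t [Kt /= tz]; split; split => //=; exact: le_trans (ltW zy).
have FK : F K by exists k => // z [].
have [p [Kp clp]] := cK F FF FK.
exists p => // y Ky; rewrite leNgt; apply/negP => yp.
have Wy : W y \is a fin_num by rewrite ge0_fin_numE// (lt_le_trans yp)// leey.
have Fy : F (K `&` [set z | W z <= W y]%E) by exists y.
have near_p : \forall z \near p, (W y < W z)%E.
  by rewrite -(fineK Wy); apply: lsc; rewrite fineK.
have [z [[_ /= zy]]] := clp _ _ Fy near_p.
by rewrite /= ltNge zy.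
Qed.

End lower_semicontinuity.

Section defect.
Context {R : realType} {m : nat}.
Local Notation V := 'rV[R]_m.
Local Notation leb := (@lebesgue_rV R m).
Implicit Types (Omega : set V) (x y : V) (kappa : R -> R) (rho : R).

(** Monotonicity starts at positive radii, since a kernel that is singular at
    the origin takes a default value there. *)
Definition truncated_kernel rho kappa :=
  [/\ measurable_fun setT kappa, forall r, 0 <= kappa r,
      forall r, rho <= r -> kappa r = 0 &
      forall r s, 0 < r -> r < s -> r < rho -> kappa s < kappa r].

(** The loss incurred by replacing a large ball about x with Omega. Unlike the
    integral over Omega it is meaningful, with values in [0, +oo], for kernels
    of any singularity, and it is an integral over an open set. *)
Definition defect kappa Omega x : \bar R :=
  (\int[leb]_(y in ~` Omega) (kappa (enorm (x - y)))%:E)%E.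

Lemma truncated_kernel_le rho kappa r s : truncated_kernel rho kappa ->
  0 < r -> r <= s -> kappa s <= kappa r.
Proof.
move=> [_ k0 kt kd] r0; rewrite le_eqVlt => /predU1P[->//|rs].
have [rr|rr] := ltP r rho; first by apply/ltW; exact: kd.
by rewrite !kt//; lra.
Qed.

Lemma measurable_kernel_enorm kappa x : measurable_fun setT kappa ->
  measurable_fun setT (fun y : V => (kappa (enorm (x - y)))%:E).
Proof.
move=> mk; apply/measurable_EFinP; apply: (measurableT_comp mk).
apply: (measurableT_comp measurable_enorm).
exact: (measurable_rVB (measurable_cst x) (@measurable_id _ _ _)).
Qed.

Lemma defect_ge0 rho kappa Omega x : truncated_kernel rho kappa ->
  (0 <= defect kappa Omega x)%E.
Proof. by move=> [_ k0 _ _]; apply: integral_ge0 => y _; rewrite lee_fin. Qed.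

Lemma defect_fin_num rho kappa Omega x : truncated_kernel rho kappa ->
  (defect kappa Omega x < +oo)%E -> defect kappa Omega x \is a fin_num.
Proof. by move=> tk; rewrite ge0_fin_numE//; exact: defect_ge0 tk. Qed.

Lemma defectE rho kappa Omega x : truncated_kernel rho kappa ->
  measurable Omega ->
  defect kappa Omega x =
  (\int[leb]_(h in [set h | (~` Omega) (h + x)%R]) (kappa (enorm h))%:E)%E.
Proof.
move=> [mk k0 _ _] mO; rewrite /defect.
rewrite (ge0_integral_preserving (measurable_shift x)).
- apply: eq_integral => h _; congr (kappa _)%:E.
  by rewrite -enormN opprB addrK.
- by move=> A mA; exact: lebesgue_rV_shift.
- exact: measurableC.
- by apply: measurable_funTS; exact: measurable_kernel_enorm.
- by move=> y _; rewrite lee_fin.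
Qed.

(** The complement of Omega is open: it is exhausted by the points at distance
    at least 1/n from Omega, and a displacement of less than 1/n keeps these
    outside Omega. *)
Lemma defect_lsc rho kappa Omega : truncated_kernel rho kappa ->
  closed Omega -> forall x (a : R), (a%:E < defect kappa Omega x)%E ->
  \forall y \near x, (a%:E < defect kappa Omega y)%E.
Proof.
move=> tk cO x a; have mO := closed_measurable_rV cO.
have [mk k0 _ _] := tk.
pose E n : set V := ~` \bigcup_(z in Omega) eball (z - x) n.+1%:R^-1.
have mE n : measurable (E n).
  apply: measurableC; apply: open_measurable_rV.
  by apply: bigcup_open => z _; exact: eball_open.
have ndE : nondecreasing_seq E.
  move=> n p np; apply/subsetPset => h Eh [z Oz hz]; apply: Eh; exists z => //.
  by apply: lt_le_trans hz _; rewrite lef_pV2 ?posrE ?ltr0n// ler_nat.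
have UE : \bigcup_n E n = [set h | (~` Omega) (h + x)].
  apply/seteqP; split => h.
    move=> [n _ Eh] Oh; apply: Eh; exists (h + x) => //.
    by rewrite /eball /= addrK subrr enorm0 invr_gt0 ltr0n.
  move=> nO; have [d d0 dO] := nbhs_eball (open_nbhs_nbhs (conj (closed_openC cO) nO)).
  have [n _ /(_ n (leqnn n)) /= nd] := near_infty_natSinv_lt (PosNum d0).
  exists n => // -[z Oz]; rewrite /eball /= => hz; apply: (dO z) => //.
  rewrite /eball /= enormB; apply: lt_trans nd.
  by rewrite (_ : h + x - z = h - (z - x))// opprB addrA addrAC.
rewrite (defectE x tk mO) -UE => aW.
have mkE D : measurable_fun D (fun h : V => (kappa (enorm h))%:E).
  apply: measurable_funTS; apply/measurable_EFinP.
  exact: (measurableT_comp mk measurable_enorm).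
have cvgE := @ge0_nondecreasing_set_cvg_integral _ _ R E
  (fun h => (kappa (enorm h))%:E) leb ndE mE (fun=> mkE _)
  (fun n h _ => eq_ind_r is_true (k0 (enorm h)) (lee_fin _ _)).
have [n _ /(_ n (leqnn n)) /= an] :=
  cvgE _ (open_nbhs_nbhs (conj (@open_ereal_gt_ereal _ a%:E) aW)).
have : nbhs x (eball x n.+1%:R^-1).
  apply: open_nbhs_nbhs; split; first exact: eball_open.
  by rewrite /eball /= subrr enorm0 invr_gt0 ltr0n.
apply: filterS => y xy; apply: lt_le_trans an _.
rewrite (defectE y tk mO); apply: ge0_subset_integral => //.
- by apply: (measurable_preim (measurable_shift y)); exact: measurableC.
- by move=> h _; rewrite lee_fin.
move=> h Eh Oh; apply: Eh; exists (h + y) => //.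
rewrite /eball /= (_ : h - (h + y - x) = x - y) 1?enormB//.
by apply/rowP => i; rewrite !mxE; ring.
Qed.

End defect.

(** * Mirror images and the defect *)

Section reflection_defect.
Context {R : realType} {m : nat}.
Hypothesis m_gt0 : (0 < m)%N.
Local Notation V := 'rV[R]_m.
Local Notation leb := (@lebesgue_rV R m).

Lemma reflection_continuous (v : V) b : continuous (reflection v b).
Proof.
move=> x; apply: (@continuousB _ V _ id (fun x => (2 * (dotv x v - b)) *: v)).
  by move=> ?; exact: cvg_id.
apply: (@continuousZ _ _ _ (fun x : V => 2 * (dotv x v - b)) (fun=> v));
  last exact: cst_continuous.
apply: (@continuousM _ _ (fun=> 2) (fun x : V => dotv x v - b)).
  exact: cst_continuous.
by apply: continuousB; [exact: dotv_continuous|exact: cst_continuous].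
Qed.

(** Passing from y to its mirror image changes the squared distance to x by
    four times the product of the signed distances of x and y to the mirror:
    the point on the side of x is the nearer one. *)
Lemma dotv_sub_reflection (v x y : V) b : esphere v ->
  let z := x - reflection v b y in
  dotv z z = dotv (x - y) (x - y) + 4 * (dotv x v - b) * (dotv y v - b).
Proof.
rewrite /esphere/= => v1; have vv : dotv v v = 1 by rewrite -sqr_enorm v1 expr1n.
have -> : x - reflection v b y = (x - y) + (2 * (dotv y v - b)) *: v.
  by apply/rowP => i; rewrite /reflection !mxE; ring.
have := dotvBl x y v; move: (x - y) => w wv /=.
rewrite !dotvE (dotvC v w) wv vv; ring.
Qed.

(** Folding the half space beyond the hyperplane onto the other one: pairing y
    with its mirror image, a point of the complement of Omega counts at least
    as much for x as for the mirror image of x, because the complement is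
    larger on the side of x, and strictly more where only y is missing from
    Omega. *)
Lemma defect_reflection_lt rho (kappa : R -> R) (Omega : set V) (v x : V) b :
  truncated_kernel rho kappa -> closed Omega -> esphere v -> b < dotv x v ->
  (forall y, Omega y -> b < dotv y v -> Omega (reflection v b y)) ->
  Omega `<=` eball (reflection v b x) rho ->
  (defect kappa Omega (reflection v b x) < +oo)%E ->
  (exists y, [/\ b < dotv y v, ~ Omega y & Omega° (reflection v b y)]) ->
  (defect kappa Omega (reflection v b x) < defect kappa Omega x)%E.
Proof.
move=> tk cO v1 bx fold Orho fin [y0 [by0 nOy0 iOy0]].
have [mk k0 kt kd] := tk.
set sg := reflection v b; set x' := sg x.
have sgK : involutive sg := reflectionK b v1.
pose E := ~` Omega; have mE : measurable E.
  by apply: measurableC; exact: closed_measurable_rV.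
have msg : measurable_fun setT sg := measurable_reflection v b.
have swap z y : enorm (z - sg y) = enorm (sg z - y).
  by rewrite -{2}(sgK y) enorm_reflection.
have m1 z : measurable_fun setT (fun y => \1_E y * kappa (enorm (z - y))).
  apply: measurable_funM; first exact: measurable_indic.
  by apply/measurable_EFinP; exact: measurable_kernel_enorm.
have m2 z : measurable_fun setT (fun y => \1_E (sg y) * kappa (enorm (z - y))).
  apply: measurable_funM.
    exact: (measurableT_comp (measurable_indic mE) msg).
  by apply/measurable_EFinP; exact: measurable_kernel_enorm.
have W1 z : defect kappa Omega z =
    (\int[leb]_y (\1_E y * kappa (enorm (z - y)))%:E)%E.
  rewrite /defect integral_mkcond; apply: eq_integral => y _.
  by rewrite patchE indicE; case: ifP => _; rewrite ?mul1r ?mul0r.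
have W2 z : defect kappa Omega z =
    (\int[leb]_y (\1_E (sg y) * kappa (enorm (sg z - y)))%:E)%E.
  rewrite W1 (ge0_integral_preserving msg).
  - by apply: eq_integral => y _; rewrite swap.
  - by move=> A mA; exact: lebesgue_rV_reflection.
  - exact: measurableT.
  - exact/measurable_EFinP.
  - by move=> y _; rewrite lee_fin mulr_ge0.
pose f y := \1_E y * kappa (enorm (x - y)) + \1_E (sg y) * kappa (enorm (x' - y)).
pose g y := \1_E y * kappa (enorm (x' - y)) + \1_E (sg y) * kappa (enorm (x - y)).
(* g <= f may fail at y = x and y = x', where the kernel takes a default value;
   truncation keeps h nonnegative, and f = g + h still holds almost
   everywhere. *)
pose h y := Order.max (f y - g y) 0.
have fW : (\int[leb]_y (f y)%:E = defect kappa Omega x + defect kappa Omega x)%E.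
  rewrite {1}W1 W2 -ge0_integralD//.
  - by move=> y _; rewrite lee_fin mulr_ge0.
  - exact/measurable_EFinP.
  - by move=> y _; rewrite lee_fin mulr_ge0.
  - exact/measurable_EFinP.
have gW : (\int[leb]_y (g y)%:E = defect kappa Omega x' + defect kappa Omega x')%E.
  rewrite {1}W1 W2 sgK -ge0_integralD//.
  - by move=> y _; rewrite lee_fin mulr_ge0.
  - exact/measurable_EFinP.
  - by move=> y _; rewrite lee_fin mulr_ge0.
  - exact/measurable_EFinP.
have mf : measurable_fun setT f by apply: measurable_funD.
have mg : measurable_fun setT g by apply: measurable_funD.
have mh : measurable_fun setT h.
  by apply: measurable_maxr => //; apply: measurable_funB.
have h0 y : 0 <= h y by rewrite /h le_max lexx orbT.
have fgE y : f y - g y = (\1_E y - \1_E (sg y)) *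
    (kappa (enorm (x - y)) - kappa (enorm (x - sg y))).
  by rewrite /f /g swap; ring.
have far y : b < dotv y v -> enorm (x - y) < enorm (x - sg y).
  move=> yb; rewrite ltr_enorm dotv_sub_reflection// ltrDl.
  by rewrite !mulr_gt0 ?subr_gt0.
have near y : dotv y v <= b -> enorm (x - sg y) <= enorm (x - y).
  move=> yb; rewrite ler_enorm dotv_sub_reflection// gerDl.
  by rewrite mulr_ge0_le0 ?subr_le0// mulr_ge0// subr_ge0 ltW.
have fg y : y != x -> y != x' -> g y <= f y.
  move=> yx yx'; rewrite -subr_ge0 fgE.
  have [yb|yb] := ltP b (dotv y v).
    apply: mulr_ge0.
      rewrite subr_ge0 !indicE ler_nat; case: (boolP (sg y \in E)) => //.
      rewrite inE => Ey; rewrite (@mem_set _ E)// => Oy.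
      by apply: Ey; exact: fold.
    rewrite subr_ge0; apply: (truncated_kernel_le tk); last exact/ltW/far.
    by rewrite enorm_gt0 subr_eq0 eq_sym.
  apply: mulr_le0.
    rewrite subr_le0 !indicE ler_nat; case: (boolP (y \in E)) => //.
    rewrite inE => Ey; rewrite (@mem_set _ E)// => Oy.
    have ynb : dotv y v != b.
      apply/eqP => yE; apply: Ey; rewrite /E /= in Oy *.
      by rewrite /sg /reflection yE subrr mulr0 scale0r subr0 in Oy.
    apply: Ey; rewrite -(sgK y); apply: fold => //.
    by rewrite dotv_reflection//; move/eqP: ynb; lra.
  rewrite subr_le0; apply: (truncated_kernel_le tk); last exact: near.
  rewrite swap enorm_gt0 subr_eq0 eq_sym//.
pose N : set V := [set y | b < dotv y v] `&` E `&` sg @^-1` Omega°.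
have oN : open N.
  apply: openI; last first.
    apply: open_comp; last exact: open_interior.
    by move=> y _; exact: reflection_continuous.
  apply: openI; last exact: closed_openC.
  apply: (@open_comp _ _ (fun y => dotv y v) [set t | b < t]).
    by move=> y _; exact: dotv_continuous.
  exact: open_gt.
have hN y : N y -> y != x -> 0 < h y.
  move=> [[yb nOy] iOy] yx; rewrite /h lt_max fgE; apply/orP; left.
  have Oy : Omega (sg y) by exact: interior_subset iOy.
  have nEs : (sg y \in E) = false by apply: memNset => /(_ Oy).
  rewrite !indicE nEs mem_set// subr0 mul1r subr_gt0; apply: kd; last first.
  - by have := Orho _ Oy; rewrite /eball /= -/sg enormB enorm_reflection.
  - exact: far.
  - by rewrite enorm_gt0 subr_eq0 eq_sym.
have H0 : (0 < \int[leb]_y (h y)%:E)%E.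
  rewrite lt_neqAle integral_ge0 ?andbT; last by move=> y _; rewrite lee_fin.
  apply/eqP => H0.
  have : (\int[leb]_y `|(h y)%:E| = 0)%E.
    by rewrite [RHS]H0; apply: eq_integral => y _; rewrite gee0_abs// lee_fin.
  have mhE : measurable_fun setT (EFin \o h) by exact/measurable_EFinP.
  move=> /(ae_eq_integral_abs leb measurableT mhE)[Z [mZ Z0 ZN]].
  have : (leb N <= leb (Z `|` [set x]))%E.
    apply: le_measure; rewrite ?inE.
    - exact: open_measurable_rV.
    - by apply: measurableU => //; exact: measurable_rV_set1.
    move=> y Ny; have [->|yx] := eqVneq y x; [by right|left; apply: ZN => /=].
    by move=> /(_ Logic.I)[]; apply/eqP; rewrite gt_eqF// hN.
  rewrite leNgt; apply/negP; rewrite negbK.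
  rewrite measureU0//; last 2 first.
  - by exact: measurable_rV_set1.
  - exact: lebesgue_rV_set1.
  rewrite [X in (X < _)%E]Z0; apply: open_lebesgue_gt0 => //.
  by exists y0.
have E2 : (defect kappa Omega x + defect kappa Omega x =
    defect kappa Omega x' + defect kappa Omega x' + \int[leb]_y (h y)%:E)%E.
  rewrite -fW -gW -ge0_integralD//.
  - apply: ge0_ae_eq_integral => //.
    + exact/measurable_EFinP.
    + by apply: emeasurable_funD; exact/measurable_EFinP.
    + by move=> y _; rewrite lee_fin addr_ge0// mulr_ge0.
    + by move=> y _; rewrite lee_fin addr_ge0// addr_ge0// mulr_ge0.
    exists ([set x] `|` [set x']); split.
    + by apply: measurableU; exact: measurable_rV_set1.
    + rewrite measureU0//; try by exact: measurable_rV_set1.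
        exact: lebesgue_rV_set1.
      exact: lebesgue_rV_set1.
    move=> y /= nfg; have [->|yx] := eqVneq y x; first by left.
    have [->|yx'] := eqVneq y x'; first by right.
    exfalso; apply: nfg => _; rewrite -EFinD; congr EFin.
    by rewrite /h max_l ?subr_ge0 ?fg// addrC subrK.
  - by move=> y _; rewrite lee_fin addr_ge0// mulr_ge0.
  - exact/measurable_EFinP.
  - by move=> y _; rewrite lee_fin.
  - exact/measurable_EFinP.
rewrite ltNge; apply/negP => le; move: E2.
have Wx0 := defect_ge0 Omega x tk; have Wx'0 := defect_ge0 Omega x' tk.
have fx' : defect kappa Omega x' \is a fin_num by rewrite ge0_fin_numE.
have fx : defect kappa Omega x \is a fin_num.
  by rewrite ge0_fin_numE// (le_lt_trans le).
move: le H0; rewrite -(fineK fx) -(fineK fx') lee_fin.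
case: (\int[leb]_y (h y)%:E)%E => [r| |] //= le; rewrite ?lte_fin => r0.
by rewrite -!EFinD => -[]; lra.
Qed.

End reflection_defect.

(** * Folding a body *)

Section fold_geometry.
Context {R : realType} {m : nat}.
Local Notation V := 'rV[R]_m.
Variables (Omega : set V) (v : V) (b : R).
Hypotheses (Omega_neq0 : Omega !=set0) (Omega_body : body Omega).
Hypotheses (v1 : esphere v) (lb : fold_level Omega v < b).

Let M := support_value Omega v.

Let slab : exists2 r, 0 < r & forall y, Omega y -> - r < dotv y v < r.
Proof.
have [r r0 Or] := compact_eball 0 Omega_body.1.
exists r => // y /Or; rewrite /eball /= subr0 => yr.
have := dotv_le y v; have := dotv_le (- y) v.
rewrite dotvNl enormN (v1 : enorm v = 1) mulr1 => ? ?.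
by apply/andP; split; lra.
Qed.

Let has_sup_slab : has_sup [set dotv x v | x in Omega].
Proof.
have [r _ Or] := slab; split; first by case: Omega_neq0 => y Oy; exists (dotv y v), y.
by exists r => _ [y /Or /andP[_ ?] <-]; exact: ltW.
Qed.

Let le_support y : Omega y -> dotv y v <= M.
Proof. by move=> Oy; apply: sup_upper_bound => //; exists y. Qed.

Let foldable := [set a | a <= M /\
  forall c, a <= c <= M -> reflection v c @` cap Omega v c `<=` Omega].

Let foldable_near c : fold_level Omega v < c -> exists2 a, foldable a & a < c.
Proof.
move=> lc; apply: inf_lt lc; exists M; split => // c' /andP[Mc' _] z [y [Oy /= yc'] _].
by have := le_support Oy; lra.
Qed.

Lemma fold_inside c y : fold_level Omega v < c ->
  Omega y -> c < dotv y v -> Omega (reflection v c y).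
Proof.
move=> /foldable_near[a [aM fa] ac] Oy cy.
apply: (fa c); last by exists y.
by rewrite (ltW ac)/=; have := le_support Oy; lra.
Qed.

(** If Omega were symmetric in a hyperplane above the fold level, a slightly
    lower fold followed by that symmetry would move the top of Omega further
    up. *)
Lemma fold_strict :
  exists y, [/\ b < dotv y v, ~ Omega y & Omega° (reflection v b y)].
Proof.
apply: contrapT => nwit.
have [cO OE] := Omega_body.
have clO : closed Omega by rewrite OE; exact: closed_closure.
have symi y : Omega° y -> dotv y v < b -> Omega (reflection v b y).
  move=> iy yb; apply: contrapT => nO; apply: nwit; exists (reflection v b y).
  by rewrite reflectionK// dotv_reflection//; split => //; lra.
have sym y : Omega y -> dotv y v < b -> Omega (reflection v b y).
  move=> Oy yb; rewrite OE in Oy; apply: clO => U nU.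
  have : nbhs y ((reflection v b @^-1` U) `&` [set z | dotv z v < b]).
    apply: filterI; first exact: (reflection_continuous nU).
    apply: (@open_nbhs_nbhs _ y); split => //.
    apply: (@open_comp _ _ (fun y => dotv y v) [set t | t < b]).
      by move=> ? _; exact: dotv_continuous.
    exact: open_lt.
  move=> /Oy[z [iz [Uz zb]]]; exists (reflection v b z).
  by split => //; exact: symi.
have bM : b <= M.
  have [z Oz] := Omega_neq0; have [bz|zb] := leP b (dotv z v).
    exact: le_trans bz (le_support Oz).
  by have := le_support (sym _ Oz zb); rewrite dotv_reflection//; lra.
pose c := (fold_level Omega v + b) / 2.
have lc : fold_level Omega v < c := (midf_lt lb).1.
have cb : 0 < b - c by rewrite subr_gt0 (midf_lt lb).2.
have [_ [p Op <-] pM] := sup_adherent cb has_sup_slab.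
rewrite -/(support_value Omega v) -/M in pM.
have Oq : Omega (reflection v c p) by apply: fold_inside => //; lra.
have qb : dotv (reflection v c p) v < b by rewrite dotv_reflection//; lra.
by have := le_support (sym _ Oq qb); rewrite !dotv_reflection//; lra.
Qed.

Lemma interior_fold x : Omega° x -> b < dotv x v -> Omega° (reflection v b x).
Proof.
move=> ix bx.
have : nbhs (reflection v b x)
    (reflection v b @^-1` (Omega° `&` [set z | b < dotv z v])).
  apply: reflection_continuous; rewrite reflectionK//; apply: open_nbhs_nbhs.
  split => //; apply: openI; first exact: open_interior.
  apply: (@open_comp _ _ (fun y => dotv y v) [set t | b < t]).
    by move=> ? _; exact: dotv_continuous.
  exact: open_gt.
apply: filterS => z [iz bz]; rewrite -(reflectionK b v1 z).
by apply: fold_inside => //; exact: interior_subset.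
Qed.

End fold_geometry.

(** * Truncated Riesz kernels *)

Section riesz_kernel.
Context {R : realType} {m : nat}.
Hypothesis m2 : (2 <= m)%N.
Local Notation V := 'rV[R]_m.
Local Notation leb := (@lebesgue_rV R m).
Implicit Types (Omega : set V) (x y : V) (alpha rho r s : R).

(** For alpha >= m a center minimizes the integral of this function of the
    distance over Omega. *)
Definition rising alpha r : R :=
  if alpha == m%:R then ln r else r `^ (alpha - m%:R).

(** A power of negative exponent is decreasing and nonnegative as it stands;
    an increasing function has to be flipped and lifted by its value at
    radius rho. *)
Definition riesz_kernel alpha rho r : R :=
  if r < rho then
    if alpha < m%:R then r `^ (alpha - m%:R)
    else rising alpha rho - rising alpha r
  else 0.

(** The bound 1 <= rho keeps the kernel nonnegative at radii r <= 0, where the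
    logarithm and the powers have default values 0 or 1. *)
Lemma riesz_kernel_truncated alpha rho : 1 <= rho ->
  truncated_kernel rho (riesz_kernel alpha rho).
Proof.
move=> rho1; split.
- apply: measurable_fun_ifT => //.
    by apply: measurable_fun_ltr.
  case: ltP => _; first exact: measurable_powR.
  apply: measurable_funB => //; rewrite /rising.
  by case: eqP => _; [exact: measurable_ln|exact: measurable_powR].
- move=> r; rewrite /riesz_kernel; case: ltP => // rrho.
  case: ltP => [_|am]; first exact: powR_ge0.
  rewrite subr_ge0 /rising; case: eqVneq => [_|amn].
    have [r0|r0] := leP r 0; first by rewrite (ln0 r0) ln_ge0.
    by rewrite ler_ln ?posrE; lra.
  have p0 : 0 < alpha - m%:R by rewrite subr_gt0 lt_neqAle eq_sym amn.
  have rho_ge1 : 1 <= rho `^ (alpha - m%:R).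
    by have := ler_powR rho1 (ltW p0); rewrite powRr0.
  have [r0|r0] := ltP r 0; first by rewrite lt0_powR1.
  by apply: (ge0_ler_powR (ltW p0)); rewrite ?nnegrE ?(ltW rrho)//; lra.
- by move=> r rr; rewrite /riesz_kernel ltNge rr.
- move=> r s r0 rs rrho; rewrite /riesz_kernel rrho.
  have rising_lt t u : m%:R <= alpha -> 0 < t -> t < u ->
      rising alpha t < rising alpha u.
    move=> am t0 tu; rewrite /rising; case: eqVneq => [_|amn].
      by rewrite ltr_ln ?posrE//; lra.
    have p0 : 0 < alpha - m%:R by rewrite subr_gt0 lt_neqAle eq_sym amn.
    by rewrite gt0_ltr_powR ?nnegrE//; lra.
  case: (ltP alpha) => am; last first.
    case: (ltP s rho) => [srho|_]; last by rewrite subr_gt0 rising_lt.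
    by rewrite ltrD2l ltrN2 rising_lt.
  case: (ltP s rho) => _; last exact: powR_gt0.
  have -> : alpha - m%:R = - (m%:R - alpha) by rewrite opprB.
  have p0 : 0 < m%:R - alpha by lra.
  rewrite !powRN ltf_pV2 ?posrE ?powR_gt0//; last lra.
  by rewrite gt0_ltr_powR ?nnegrE//; lra.
Qed.

(** For alpha below m the kernel is a power on shells, so only the power
    integral at the origin decides integrability. *)
Lemma integral_cone_kernel (K : set V) alpha rho a b :
  measurable K -> is_cone K -> alpha < m%:R -> 0 < a -> a < b -> b <= rho ->
  (\int[leb]_(w in K `&` shell a b) (riesz_kernel alpha rho (enorm w))%:E =
   (m%:R * cone_volume K * (power_primitive alpha b - power_primitive alpha a))%:E)%E.
Proof.
move=> mK coneK am a0 ab brho; rewrite -integral_cone_shell//.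
apply: eq_integral => w; rewrite inE => -[_ /andP[_ wb]].
by rewrite /riesz_kernel am ifT//; exact: lt_le_trans brho.
Qed.

Lemma measurable_riesz_kernel alpha rho : measurable_fun setT (riesz_kernel alpha rho) ->
  forall D : set V,
  measurable_fun D (fun w : V => (riesz_kernel alpha rho (enorm w))%:E).
Proof.
move=> mk D; apply: measurable_funTS; apply/measurable_EFinP.
exact: (measurableT_comp mk measurable_enorm).
Qed.

(** The punctured ball is exhausted by shells, on which the integrals stay
    bounded since the primitive r^alpha / alpha is nonnegative. *)
Lemma kernel_mass_lt alpha rho : 0 < alpha -> alpha < m%:R -> 1 <= rho ->
  (\int[leb]_w (riesz_kernel alpha rho (enorm w))%:E < +oo)%E.
Proof.
move=> a0 am rho1; have [mk k0 kt _] := riesz_kernel_truncated alpha rho1.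
pose E n := shell n.+1%:R^-1 rho : set V.
have mE n : measurable (E n) by exact: measurable_shell.
have ndE : nondecreasing_seq E.
  move=> n p np; apply/subsetPset => w; rewrite /E /shell /= => /andP[nw ->].
  rewrite andbT (le_trans _ nw)// lef_pV2 ?posrE ?ltr0n//.
  by rewrite ler_nat.
have -> : (\int[leb]_w (riesz_kernel alpha rho (enorm w))%:E =
    \int[leb]_(w in \bigcup_n E n) (riesz_kernel alpha rho (enorm w))%:E)%E.
  rewrite [RHS]integral_mkcond; apply: eq_integral => w _.
  rewrite patchE; case: ifPn => //; rewrite notin_setE => nE.
  have [->|w0] := eqVneq w 0.
    rewrite enorm0 /riesz_kernel am powR0 ?if_same//.
    by rewrite subr_eq0 lt_eqF.
  rewrite kt// leNgt; apply/negP => wrho; apply: nE.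
  have [n _ /(_ n (leqnn n)) /= nw] :=
    near_infty_natSinv_lt (PosNum (etrans (enorm_gt0 w) w0)).
  by exists n => //; rewrite /E /shell /= (ltW nw).
have cvgE := @ge0_nondecreasing_set_cvg_integral _ _ R E
  (fun w => (riesz_kernel alpha rho (enorm w))%:E) leb ndE mE
  (fun n => @measurable_riesz_kernel alpha rho mk (E n))
  (fun n h _ => eq_ind_r is_true (k0 (enorm h)) (lee_fin _ _)).
rewrite -(cvg_lim _ cvgE)//.
pose B := m%:R * cone_volume [set: V] * power_primitive alpha rho.
apply: (@le_lt_trans _ _ B%:E); last exact: ltry.
apply: lime_le; first by apply/cvg_ex; eexists; exact: cvgE.
near=> n.
have n0 : 0 < n.+1%:R^-1 :> R by rewrite invr_gt0 ltr0n.
have n1 : n.+1%:R^-1 < rho.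
  by apply: lt_le_trans rho1; rewrite invf_lt1 ?ltr0n// ltr1n; near: n; exists 1%N.
rewrite -[E n]setTI integral_cone_kernel//.
rewrite lee_fin /B ler_wpM2l ?mulr_ge0 ?cone_volume_ge0// gerBl.
by rewrite /power_primitive gt_eqF// divr_ge0 ?powR_ge0 ?ltW.
Unshelve. all: by end_near. Qed.

(** When alpha >= m the truncated kernel is bounded, up to the singularity of
    the logarithm, which is weaker than 1/r. *)
Lemma kernel_mass_fin alpha rho : 0 < alpha -> 1 <= rho ->
  (\int[leb]_w (riesz_kernel alpha rho (enorm w))%:E < +oo)%E.
Proof.
move=> a0 rho1; have [am|ma] := ltP alpha m%:R; first exact: kernel_mass_lt.
have [mk k0 kt _] := riesz_kernel_truncated alpha rho1.
have [mk' k0' kt' _] := riesz_kernel_truncated (m%:R - 1) rho1.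
pose c := rising alpha rho.
have c0 : 0 <= c.
  by rewrite /c /rising; case: eqP => _; [exact: ln_ge0|exact: powR_ge0].
have bound r : 0 <= r ->
    riesz_kernel alpha rho r <=
    c * \1_[set t | t < rho] r + rho * riesz_kernel (m%:R - 1) rho r.
  move=> r0; have [rr|rr] := ltP r rho; last first.
    by rewrite !kt ?kt'// mulr0 addr0 mulr_ge0.
  rewrite indicE mem_set// mulr1 /riesz_kernel rr ltNge ma /= ifT; last lra.
  rewrite /c /rising; case: eqVneq => [_|_]; last first.
    have := powR_ge0 r (alpha - m%:R).
    have := mulr_ge0 (le_trans ler01 rho1) (powR_ge0 r (m%:R - 1 - m%:R)); lra.
  have [->|rn0] := eqVneq r 0.
    by rewrite (ln0 (lexx 0)) subr0 lerDl mulr_ge0 ?powR_ge0//; lra.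
  have {rn0}r0 : 0 < r by rewrite lt_neqAle eq_sym rn0.
  have -> : m%:R - 1 - m%:R = -1 :> R by ring.
  rewrite powR_inv1 ?ltW//.
  have := ln_sublinear (divr_gt0 (lt_le_trans ltr01 rho1) r0).
  by have := ln_ge0 rho1; rewrite ln_div ?posrE//; lra.
have mI : measurable [set t : R | t < rho] by apply: measurable_lt.
pose J (w : V) := c * \1_[set t | t < rho] (enorm w).
have J0 w : 0 <= J w by rewrite mulr_ge0.
have mJ : measurable_fun setT (EFin \o J).
  apply/measurable_EFinP; apply: measurable_funM => //.
  exact: (measurableT_comp (measurable_indic mI) measurable_enorm).
have Jfin : (\int[leb]_w (J w)%:E < +oo)%E.
  rewrite (_ : \int[leb]_w (J w)%:E = c%:E * leb (eball 0 rho))%E.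
    apply: lte_mul_pinfty => //; first exact: eball_lebesgue_lty.
  rewrite -[eball 0 rho]setIT -integral_indic//; last exact: measurable_eball.
  rewrite -ge0_integralZl//; last first.
    by apply/measurable_EFinP; exact: (measurable_indic (measurable_eball _ _)).
  apply: eq_integral => w _; rewrite -EFinM /J; congr (c * _)%:E; rewrite !indicE.
  have -> : (w \in eball 0 rho) = (enorm w \in [set t | t < rho]).
    by apply/idP/idP; rewrite !inE /eball /= subr0.
  by [].
apply: (@le_lt_trans _ _ (\int[leb]_w ((J w)%:E +
    rho%:E * (riesz_kernel (m%:R - 1) rho (enorm w))%:E))%E).
  apply: ge0_le_integral => //.
  - by move=> w _; rewrite lee_fin.
  - exact: (measurable_riesz_kernel mk).
  - apply: emeasurable_funD => //; apply: measurable_funeM.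
    exact: (measurable_riesz_kernel mk').
  - by move=> w _; rewrite -EFinM -EFinD lee_fin bound// enorm_ge0.
rewrite ge0_integralD//; last 3 first.
- by move=> w _; rewrite lee_fin.
- by move=> w _; rewrite -EFinM lee_fin mulr_ge0//; lra.
- by apply: measurable_funeM; exact: (measurable_riesz_kernel mk').
rewrite ge0_integralZl//; last 3 first.
- exact: (measurable_riesz_kernel mk').
- by move=> w _; rewrite lee_fin.
- by rewrite lee_fin; lra.
apply: lte_add_pinfty => //; apply: lte_mul_pinfty => //.
- by rewrite lee_fin; lra.
- apply: kernel_mass_lt => //; last lra.
  by rewrite subr_gt0 ltr1n.
Qed.

End riesz_kernel.

(** * Potentials as constants minus defects *)

Section objective.
Context {R : realType} {m : nat}.
Hypothesis m2 : (2 <= m)%N.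
Local Notation V := 'rV[R]_m.
Local Notation leb := (@lebesgue_rV R m).
Implicit Types (Omega : set V) (x y : V) (alpha rho r s : R).

(** All four cases of a center ask for a maximum of this function. *)
Definition objective alpha Omega x : \bar R :=
  if alpha > m%:R then (- potential alpha Omega x)%E
  else if alpha == m%:R then log_potential Omega x
  else potential alpha Omega x.

Definition center_domain alpha Omega : set V :=
  if alpha > 0 then setT else Omega°.

Lemma is_center_objective alpha Omega x :
  max_on (center_domain alpha Omega) (objective alpha Omega) x ->
  is_center alpha Omega x.
Proof.
have m0 : 0 < m%:R :> R by rewrite ltr0n; exact: leq_trans m2.
rewrite /is_center /objective /center_domain.
move: (potential alpha Omega) (log_potential Omega) => P L.
case: (ltP m%:R alpha) => [ma|am].
  rewrite (lt_trans m0 ma) => -[_ h]; split => // y _.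
  by rewrite -leeN2; exact: h.
case: eqVneq => [->|_]; first by rewrite m0.
by case: ltP.
Qed.

Variables (alpha rho : R) (Omega : set V).
Hypotheses (rho1 : 1 <= rho) (Omega_body : body Omega).
Local Notation kappa := (riesz_kernel alpha rho (m := m)).
Local Notation W := (defect kappa Omega).
Local Open Scope ereal_scope.

Let tk : truncated_kernel rho kappa := riesz_kernel_truncated alpha rho1.
Let k0 r : (0 <= kappa r)%R. Proof. by have [] := tk. Qed.
Let mk : measurable_fun setT kappa. Proof. by have [] := tk. Qed.

Let cO : closed Omega.
Proof. by rewrite Omega_body.2; exact: closed_closure. Qed.

Let mO : measurable Omega.
Proof. exact: closed_measurable_rV. Qed.

Let mkx x (D : set V) : measurable_fun D (fun y => (kappa (enorm (x - y)))%:E).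
Proof. by apply: measurable_funTS; exact: measurable_kernel_enorm. Qed.

Lemma integral_kernel_shift x (D : set V) : measurable D ->
  \int[leb]_(y in [set y | D (y - x)%R]) (kappa (enorm (x - y)))%:E =
  \int[leb]_(h in D) (kappa (enorm h))%:E.
Proof.
move=> mD; rewrite [RHS](ge0_integral_preserving (measurable_shift (- x)%R)).
- by apply: eq_integral => y _; rewrite enormB.
- by move=> A mA; exact: lebesgue_rV_shift.
- exact: mD.
- exact: (measurable_riesz_kernel mk).
- by move=> y _; rewrite lee_fin.
Qed.

Lemma defect_complement x (D : set V) : measurable D -> ~` Omega `<=` D ->
  \int[leb]_(y in D) (kappa (enorm (x - y)))%:E =
  \int[leb]_(y in D `&` Omega) (kappa (enorm (x - y)))%:E + W x.
Proof.
move=> mD OD.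
have -> : W x = \int[leb]_(y in D `\` Omega) (kappa (enorm (x - y)))%:E.
  by rewrite setDE setIidr.
rewrite -ge0_integral_setU//.
- by rewrite setUIDK.
- exact: measurableI.
- exact: measurableD.
- by move=> y _; rewrite lee_fin.
- by apply/disj_setPS => y [[_ ?] []].
Qed.

(** The kernel is integrable over the ball of radius rho about x, with an
    integral that does not depend on x. *)
Lemma objective_defect_pos : (0 < alpha)%R ->
  exists C : R, forall x, Omega `<=` eball x rho ->
    W x < +oo /\ objective alpha Omega x = C%:E - W x.
Proof.
move=> a0.
have [p pE] : exists p : R,
    \int[leb]_w (kappa (enorm w))%:E = p%:E.
  have Pfin := kernel_mass_fin m2 a0 rho1.
  exists (fine (\int[leb]_w (kappa (enorm w))%:E)); rewrite fineK// ge0_fin_numE//.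
  by apply: integral_ge0 => w _; rewrite lee_fin.
have Olt : leb Omega < +oo.
  have [r _ Or] := compact_eball 0%R Omega_body.1.
  apply: le_lt_trans (eball_lebesgue_lty 0%R r).
  by apply: le_measure; rewrite ?inE//; exact: measurable_eball.
have Ofin : leb Omega \is a fin_num by rewrite ge0_fin_numE.
pose G x := \int[leb]_(y in Omega) (kappa (enorm (x - y)))%:E.
have G0 x : 0 <= G x by apply: integral_ge0 => y _; rewrite lee_fin.
have W0 x : 0 <= W x := defect_ge0 Omega x tk.
have GW x : G x + W x = p%:E.
  rewrite -pE -(integral_kernel_shift x measurableT).
  by rewrite (@defect_complement x setT)// setTI.
have Gfin x : G x \is a fin_num.
  rewrite ge0_fin_numE//; apply: (@le_lt_trans _ _ p%:E); last exact: ltry.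
  by rewrite -(GW x) leeDl.
have Wfin x : W x \is a fin_num.
  rewrite ge0_fin_numE//; apply: (@le_lt_trans _ _ p%:E); last exact: ltry.
  by rewrite -(GW x) leeDr.
have PW x : G x = p%:E - W x by rewrite -(GW x) addeK.
have potE x : potential alpha Omega x = riesz_integral alpha Omega x.
  by rewrite /potential; case: asboolP => // -[]; rewrite leNgt a0.
have [am|ma] := ltP alpha m%:R.
  exists p => x Ox; split; first by rewrite ltey_eq Wfin.
  rewrite /objective ltNge (ltW am)/= lt_eqF// potE -PW.
  apply: eq_integral => y /[!inE] Oy.
  by rewrite /riesz_kernel am; have := Ox _ Oy; rewrite /eball/= enormB => ->.
pose c := rising (m := m) alpha rho.
exists (p - c * fine (leb Omega))%R => x Ox.
split; first by rewrite ltey_eq Wfin.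
have -> : objective alpha Omega x =
    - \int[leb]_(y in Omega) (rising (m := m) alpha (enorm (x - y)))%:E.
  rewrite /objective /rising; case: (ltP m%:R alpha) => [ma'|am].
    by rewrite potE (gt_eqF ma').
  by have -> : (alpha == m%:R) = true by rewrite eq_le am.
have -> : \int[leb]_(y in Omega) (rising (m := m) alpha (enorm (x - y)))%:E =
    \int[leb]_(y in Omega) (c%:E - (kappa (enorm (x - y)))%:E).
  apply: eq_integral => y /[!inE] Oy; rewrite -EFinB; congr EFin.
  have := Ox _ Oy; rewrite /eball/= enormB /riesz_kernel => ->.
  by rewrite ltNge ma /= /c; ring.
rewrite integralB//; last 2 first.
- apply/integrableP; split; first exact: measurable_cst.
  rewrite (eq_integral (cst `|c|%R%:E))//.
  by rewrite integral_cst//; apply: lte_mul_pinfty; [rewrite lee_fin|by []|exact: Olt].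
- apply/integrableP; split => //.
  rewrite (eq_integral (fun y => (kappa (enorm (x - y)))%:E)) => [|y _].
    by rewrite -/(G x) ltey_eq Gfin.
  by rewrite gee0_abs// lee_fin.
have -> : \int[leb]_(y in Omega) c%:E = (c * fine (leb Omega))%:E.
  by rewrite EFinM fineK//; exact: integral_cst.
rewrite -/(G x) PW -(fineK (Wfin x)) -!EFinB.
by rewrite -EFinN; congr EFin; ring.
Qed.

Lemma divergent_partE e : (0 < e)%R ->
  divergent_part m alpha e = (- (sphere_area m * power_primitive alpha e))%R.
Proof.
move=> e0; rewrite /divergent_part /power_primitive.
case: eqVneq => [_|an0]; first by rewrite div1r lnV ?posrE// mulrN.
by rewrite powRN invrK; field.
Qed.

(** Cutting the ball of radius e about x out of the ball of radius rho leaves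
    a shell whose integral is, up to a constant, the divergent part; the
    counterterm therefore removes all dependence on e. *)
Lemma objective_defect_nonpos : (alpha <= 0)%R ->
  exists C : R, forall x, Omega° x -> Omega `<=` eball x rho ->
    W x < +oo /\ objective alpha Omega x = C%:E - W x.
Proof.
move=> a0.
have am : (alpha < m%:R)%R.
  by apply: le_lt_trans a0 _; rewrite ltr0n; exact: leq_trans m2.
pose C := (sphere_area m * power_primitive alpha rho)%R.
exists C => x iOx Orho.
have [d d0 dO] := nbhs_eball iOx.
have split_shell e : (0 < e)%R -> (e < d)%R -> (e < rho)%R ->
    riesz_integral alpha (Omega `\` eball x e) x + W x =
    (C + divergent_part m alpha e)%:E.
  move=> e0 ed er.
  pose D := [set h : V | (e <= enorm h)%R].
  have mD : measurable D.
    rewrite (_ : D = ~` eball 0%R e); last first.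
      apply/seteqP; split => h; rewrite /D /eball /= subr0 leNgt; first by move/negP.
      by move/negP.
    by apply: measurableC; exact: measurable_eball.
  have <- : \int[leb]_(h in D) (kappa (enorm h))%:E = (C + divergent_part m alpha e)%:E.
    have mT : is_cone [set: V] by [].
    have := integral_cone_kernel m2 measurableT mT am e0 er (lexx _).
    rewrite -sphere_area_volume// divergent_partE// setTI mulrBr => <-.
    rewrite integral_mkcond [RHS]integral_mkcond; apply: eq_integral => h _.
    rewrite !patchE; case: (boolP (h \in D)) => hD;
      case: (boolP (h \in shell e rho)) => hs //.
      have [_ _ -> //] := tk; move: hD hs; rewrite inE notin_setE /D /shell /= => eh.
      by move=> /negP; rewrite eh /= -leNgt.
    move: hD hs; rewrite inE notin_setE /D /shell /= => neh.
    by move=> /andP[].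
  have mDx : measurable [set y | D (y - x)%R].
    by apply: (measurable_preim (measurable_shift _)).
  rewrite -(integral_kernel_shift x mD) (defect_complement x mDx); last first.
    move=> y nOy; rewrite /D /= leNgt; apply/negP => ye; apply: nOy.
    by apply: dO; rewrite /eball /=; exact: lt_trans ye ed.
  congr (_ + _).
  rewrite /riesz_integral (_ : Omega `\` eball x e =
    [set y | D (y - x)%R] `&` Omega); last first.
    apply/seteqP; split => y; rewrite /D /eball /=.
      by move=> [Oy /negP]; rewrite -leNgt.
    by move=> [ye Oy]; split => //; apply/negP; rewrite -leNgt.
  apply: eq_integral => y /[!inE] -[_ Oy].
  by rewrite /riesz_kernel am; have := Orho _ Oy; rewrite /eball/= enormB => ->.
have W0 : 0 <= W x := defect_ge0 Omega x tk.
have rho0 : (0 < rho)%R by apply: lt_le_trans rho1.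
have riesz0 A : 0 <= riesz_integral alpha A x.
  by apply: integral_ge0 => y _; rewrite lee_fin powR_ge0.
have Wfin : W x \is a fin_num.
  pose e := (Order.min d rho / 2)%R.
  have e0 : (0 < e)%R by rewrite divr_gt0// lt_min d0.
  have [ed er] : (e < d)%R /\ (e < rho)%R.
    have : (e < Order.min d rho)%R by rewrite /e ltr_pdivrMr// ltr_pMr ?lt_min ?d0// ltr1n.
    by rewrite lt_min => /andP[].
  rewrite ge0_fin_numE//; apply: (@le_lt_trans _ _ (C + divergent_part m alpha e)%:E).
    by rewrite -split_shell// leeDr.
  exact: ltry.
split; first by rewrite ltey_eq Wfin.
rewrite /objective ltNge (ltW am)/= lt_eqF// /potential asboolT//.
apply: cvg_lim => //.
apply: (@cvg_trans _ (cst (C%:E - W x) e @[e --> 0^'+])); last exact: cvg_cst.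
apply: near_eq_cvg; near=> e.
have e0 : (0 < e)%R by [].
have ed : (e < d)%R by near: e; exact: nbhs_right_lt.
have er : (e < rho)%R by near: e; exact: nbhs_right_lt.
have E := split_shell e e0 ed er.
have rfin : riesz_integral alpha (Omega `\` eball x e) x \is a fin_num.
  rewrite ge0_fin_numE//; apply: (@le_lt_trans _ _ (C + divergent_part m alpha e)%:E).
    by rewrite -E leeDl.
  exact: ltry.
move: E; rewrite /= -(fineK rfin) -(fineK Wfin) -EFinD -!EFinB => -[E].
by congr EFin; lra.
Unshelve. all: by end_near. Qed.

End objective.

(** * Exterior cones at the boundary *)

Section boundary.
Context {R : realType} {m : nat}.
Hypothesis m2 : (2 <= m)%N.
Local Notation V := 'rV[R]_m.
Local Notation leb := (@lebesgue_rV R m).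

Definition infinite_cone (u : V) (c : R) : set V :=
  [set w | enorm w * c <= dotv w u].

Lemma is_cone_infinite_cone u c : is_cone (infinite_cone u c).
Proof.
move=> t w t0; rewrite /infinite_cone /= enormZ dotvZl gtr0_norm// -mulrA.
by rewrite ler_pM2l.
Qed.

Lemma infinite_cone_continuous u c :
  continuous (fun w : V => enorm w * c - dotv w u).
Proof.
move=> w; apply: (@continuousB _ _ _ (fun w => enorm w * c) (fun w => dotv w u));
  last exact: dotv_continuous.
apply: (@continuousM _ _ (@enorm R m) (fun=> c)); last exact: cst_continuous.
exact: enorm_continuous.
Qed.

Lemma measurable_infinite_cone u c : measurable (infinite_cone u c).
Proof.
apply: closed_measurable_rV.
rewrite (_ : infinite_cone u c = (fun w => enorm w * c - dotv w u) @^-1` [set t | t <= 0]).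
  apply: closed_comp; last exact: closed_le.
  by move=> w _; exact: infinite_cone_continuous.
by apply/seteqP; split => w; rewrite /infinite_cone /= subr_le0.
Qed.

Lemma infinite_cone_volume_gt0 u c : esphere u -> c < 1 ->
  0 < cone_volume (infinite_cone u c).
Proof.
move=> u1 c1.
apply: (@cone_volume_gt0 _ _ _
  (((fun w => enorm w * c - dotv w u) @^-1` [set t | t < 0]) `&` eball 0 1)).
- exact: measurable_infinite_cone.
- apply: openI; last exact: eball_open.
  apply: open_comp; last exact: open_lt.
  by move=> w _; exact: infinite_cone_continuous.
- exists (2^-1 *: u); split => /=; last first.
    by rewrite /eball /= subr0 enormZ (u1 : enorm u = 1) ger0_norm//; lra.
  rewrite enormZ dotvZl -sqr_enorm (u1 : enorm u = 1) ger0_norm//; lra.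
- move=> w [/= wu w1]; split => //; rewrite /infinite_cone /=; lra.
Qed.

(** Bounding every exponent by the logarithm gives one rate of divergence for
    all alpha <= 0. *)
Lemma power_primitive_le_ln (alpha e : R) : alpha <= 0 -> 0 < e ->
  power_primitive alpha e <= ln e.
Proof.
move=> a0 e0; rewrite /power_primitive; case: eqVneq => // an0.
have {an0}a0 : alpha < 0 by rewrite lt_neqAle an0.
rewrite ler_ndivrMr// /powR gt_eqF// mulrC.
by apply: le_trans (expR_ge1Dx _); rewrite lerDr.
Qed.

(** For alpha <= 0 the power integral over a cone diverges at its vertex. *)
Lemma defect_boundary alpha rho (Omega : set V) z :
  alpha <= 0 -> 1 <= rho -> closed Omega -> exterior_cone_condition Omega z ->
  defect (riesz_kernel alpha rho (m := m)) Omega z = +oo%E.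
Proof.
move=> a0 rho1 cO [e [theta [e0 /andP[t0 tpi] [u [h [u1 h0 coneO]]]]]].
set kappa := riesz_kernel alpha rho (m := m).
have tk : truncated_kernel rho kappa := riesz_kernel_truncated alpha rho1.
have [mk k0 _ _] := tk.
have am : alpha < m%:R.
  by apply: le_lt_trans a0 _; rewrite ltr0n; exact: leq_trans m2.
pose c := cos (theta / 2); pose K := infinite_cone u c.
have c1 : c < 1.
  have pi0 := pi_gt0 R.
  rewrite /c -[X in _ < X]cos0 ltr_cos ?in_itv/=; first lra.
    by apply/andP; split; lra.
  by apply/andP; split; lra.
have K0 : 0 < cone_volume K by exact: infinite_cone_volume_gt0.
pose r0 := Order.min h rho.
have r0h : r0 <= h by rewrite /r0 ge_min lexx.
have r0rho : r0 <= rho by rewrite /r0 ge_min lexx orbT.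
have r0_gt0 : 0 < r0 by rewrite lt_min h0; lra.
pose B := m%:R * cone_volume K.
have B0 : 0 < B by rewrite mulr_gt0// ltr0n; exact: leq_trans m2.
have lower d : 0 < d -> d < r0 ->
    ((B * (power_primitive alpha r0 - power_primitive alpha d))%:E <=
     defect kappa Omega z)%E.
  move=> d0 dr0.
  rewrite -(integral_cone_kernel m2 (measurable_infinite_cone u c)
    (@is_cone_infinite_cone u c) am d0 dr0 r0rho).
  have mO := closed_measurable_rV cO.
  rewrite (defectE z tk mO); apply: ge0_subset_integral.
  - by apply: measurableI; [exact: measurable_infinite_cone|exact: measurable_shell].
  - by apply: (measurable_preim (measurable_shift z)); exact: measurableC.
  - exact: (measurable_riesz_kernel mk).
  - by move=> w _; rewrite lee_fin.
  move=> w [Kw /andP[dw wr]].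
  have : (eball z e `&` ~` Omega) (w + z).
    apply: coneO; split.
      rewrite /cone_of_revolution /= addrK; apply/andP; split; first exact: Kw.
      apply: le_trans (dotv_le _ _) _; rewrite (u1 : enorm u = 1) mulr1.
      by rewrite ltW// (lt_le_trans wr).
    move=> /= wz; have w0 : w = 0 by apply: (addIr z); rewrite add0r.
    by move: dw; rewrite w0 enorm0; lra.
  by case.
apply/eqP; rewrite -leye_eq leNgt; apply/negP => fin.
have W0 := defect_ge0 Omega z tk.
have Wfin : defect kappa Omega z \is a fin_num by rewrite ge0_fin_numE.
move: lower; rewrite -(fineK Wfin); set M := fine _ => lower.
(* With inner radius exp(- t) the shell alone already exceeds M; the second
   bound makes this radius smaller than r0. *)
pose t := Order.max (M / B - power_primitive alpha r0) (- ln r0) + 1.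
have t1 : M / B - power_primitive alpha r0 < t.
  by rewrite /t ltr_pwDr// le_max lexx.
have t2 : - ln r0 < t by rewrite /t ltr_pwDr// le_max lexx orbT.
have d0 : 0 < expR (- t) by exact: expR_gt0.
have dr0 : expR (- t) < r0.
  by rewrite -[X in _ < X](lnK r0_gt0) ltr_expR; lra.
have := lower _ d0 dr0; rewrite lee_fin leNgt => /negP; apply.
rewrite mulrC -ltr_pdivrMr//.
by have := power_primitive_le_ln a0 d0; rewrite expRK; lra.
Qed.

End boundary.

Lemma EFin_sub_lt {R : realType} (C : R) (w w' : \bar R) :
  w \is a fin_num -> w' \is a fin_num ->
  (w' < w -> C%:E - w < C%:E - w')%E.
Proof.
by move: w w' => [w| |] [w'| |] // _ _; rewrite -!EFinB !lte_fin; lra.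
Qed.

(** * Existence and position of the centers *)

Section centers.
Context {R : realType} {m : nat}.
Hypothesis m2 : (2 <= m)%N.
Local Notation V := 'rV[R]_m.
Variables (alpha : R) (Omega : set V).
Hypotheses (Omega_neq0 : Omega !=set0) (Omega_body : body Omega).
Local Notation D := (center_domain alpha Omega).
Local Notation obj := (objective alpha Omega).
Local Notation W rho := (defect (riesz_kernel alpha rho (m := m)) Omega).

Lemma objective_defect rho : 1 <= rho ->
  exists C : R, forall x, D x -> Omega `<=` eball x rho ->
    (W rho x < +oo)%E /\ obj x = (C%:E - W rho x)%E.
Proof.
move=> rho1; rewrite /center_domain; case: ltP => a0.
  have [C h] := objective_defect_pos m2 rho1 Omega_body a0.
  by exists C => x _; exact: h.
exact: (objective_defect_nonpos m2 rho1 Omega_body a0).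
Qed.

Let cO : closed Omega.
Proof. by rewrite Omega_body.2; exact: closed_closure. Qed.

Let common_ball x y : exists rho : R,
  [/\ 1 <= rho, Omega `<=` eball x rho & Omega `<=` eball y rho].
Proof.
have [r _ Or] := compact_eball x Omega_body.1.
have [s _ Os] := compact_eball y Omega_body.1.
exists (Order.max 1 (Order.max r s)); split; first by rewrite le_max lexx.
- by move=> z /Or; rewrite /eball /= => h; rewrite !lt_max h orbT.
- by move=> z /Os; rewrite /eball /= => h; rewrite !lt_max h !orbT.
Qed.

Lemma objective_reflection_lt v b x : esphere v -> b < dotv x v ->
  D x -> D (reflection v b x) ->
  (forall y, Omega y -> b < dotv y v -> Omega (reflection v b y)) ->
  (exists y, [/\ b < dotv y v, ~ Omega y & Omega° (reflection v b y)]) ->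
  (obj x < obj (reflection v b x))%E.
Proof.
move=> v1 bx Dx Dx' fold wit.
have [rho [rho1 Ox Ox']] := common_ball x (reflection v b x).
have tk := @riesz_kernel_truncated R m alpha _ rho1.
have [C h] := objective_defect rho1.
have [Wx ->] := h _ Dx Ox; have [Wx' ->] := h _ Dx' Ox'.
have m_gt0 : (0 < m)%N by exact: leq_trans m2.
apply: EFin_sub_lt (defect_fin_num tk Wx) (defect_fin_num tk Wx') _.
exact (defect_reflection_lt m_gt0 tk cO v1 bx fold Ox' Wx' wit).
Qed.

(** If x lies above the fold level in some direction, the fold half way between
    the level and x improves the objective. *)
Lemma center_minimal_unfolded_region x : max_on D obj x ->
  minimal_unfolded_region Omega x.
Proof.
move=> [Dx mx] v v1 /=; rewrite leNgt; apply/negP => lx.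
pose b := (fold_level Omega v + dotv x v) / 2.
have lb : fold_level Omega v < b := (midf_lt lx).1.
have bx : b < dotv x v := (midf_lt lx).2.
have Dx' : D (reflection v b x).
  move: Dx; rewrite /center_domain; case: ifP => // _ Dx.
  exact: (interior_fold Omega_neq0 Omega_body v1 lb).
have fold y : Omega y -> b < dotv y v -> Omega (reflection v b y).
  by move=> Oy; exact: (fold_inside Omega_neq0 Omega_body v1 lb Oy).
have wit := fold_strict Omega_neq0 Omega_body v1 lb.
have := objective_reflection_lt v1 bx Dx Dx' fold wit.
by rewrite ltNge mx.
Qed.

Lemma interior_neq0 : Omega° !=set0.
Proof.
have [y Oy] := Omega_neq0; rewrite Omega_body.2 in Oy.
by have [z [iz _]] := Oy setT filterT; exists z.
Qed.

(** The defect is minimized on a closed ball containing Omega; every point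
    outside is beaten by a point of that ball. *)
Lemma center_exists_pos : 0 < alpha -> exists x, max_on D obj x.
Proof.
move=> a0; have DT : D = setT by rewrite /center_domain a0.
have [r r0 Or] := compact_eball 0 Omega_body.1.
pose rho := Order.max 1 (2 * r).
have rho1 : 1 <= rho by rewrite /rho le_max lexx.
have tk := @riesz_kernel_truncated R m alpha _ rho1.
pose K : set V := [set x | enorm x <= r].
have OK x : K x -> Omega `<=` eball x rho.
  move=> Kx y /Or; rewrite /eball /= subr0 => yr.
  apply: le_lt_trans (ler_enormD _ _) _; rewrite enormN.
  have : 2 * r <= rho by rewrite /rho le_max lexx orbT.
  by rewrite /K /= in Kx; lra.
have [|||x Kx xmin] := @lsc_compact_min R _ (W rho) K _ _ (@closed_eball_compact R m r).
- by move=> x; exact: (defect_ge0 _ _ tk).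
- exact: (defect_lsc tk cO).
- by exists 0; rewrite /K /= enorm0 ltW.
have [C h] := objective_defect rho1.
have xmax y : K y -> (obj y <= obj x)%E.
  have DA z : D z by rewrite DT.
  move=> Ky; have [_ ->] := h y (DA y) (OK y Ky).
  have [_ ->] := h x (DA x) (OK x Kx).
  exact: leeB (lexx _) (xmin _ Ky).
exists x; split; first by rewrite DT.
move=> y _; have [/xmax//|yr] := leP (enorm y) r.
(* The mirror of y in the hyperplane half way to the ball is the nearest point
   of the ball, and Omega lies beyond that hyperplane. *)
pose v := (enorm y)^-1 *: y.
have y0 : 0 < enorm y by lra.
have v1 : esphere v.
  by rewrite /esphere /= enormZ gtr0_norm ?invr_gt0// mulVf ?gt_eqF.
have yv : dotv y v = enorm y.
  by rewrite dotvZr -sqr_enorm expr2 mulrA mulVf ?gt_eqF// mul1r.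
pose b := (enorm y + r) / 2.
have Ov z : Omega z -> dotv z v < b.
  move=> /Or; rewrite /eball /= subr0 => zr.
  have := dotv_le z v; rewrite (v1 : enorm v = 1) mulr1 /b; lra.
have Ky' : K (reflection v b y).
  rewrite /K /= /reflection yv.
  have -> : y - (2 * (enorm y - b)) *: v = (r / enorm y) *: y.
    apply/rowP => i; rewrite /v /b !mxE; field.
    by rewrite gt_eqF.
  by rewrite enormZ gtr0_norm ?divr_gt0// divfK ?gt_eqF.
apply: le_trans (xmax _ Ky'); apply/ltW/objective_reflection_lt => //.
- by rewrite yv /b; lra.
- by rewrite DT.
- by rewrite DT.
- by move=> z /Ov; lra.
have [z iz] := interior_neq0; have zb := Ov _ (interior_subset iz).
exists (reflection v b z); rewrite dotv_reflection// reflectionK//.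
split => //; first lra.
by move=> /Ov; rewrite dotv_reflection//; lra.
Qed.

(** The defect is minimized on the compact set Omega. Its minimum is finite, and
    the exterior cones make it infinite on the boundary, so the minimizer is
    interior. *)
Lemma center_exists_nonpos : alpha <= 0 ->
  (forall z, boundary Omega z -> exterior_cone_condition Omega z) ->
  exists x, max_on D obj x.
Proof.
move=> a0 cone; have DI : D = Omega° by rewrite /center_domain ltNge a0.
have [r r0 Or] := compact_eball 0 Omega_body.1.
pose rho := Order.max 1 (2 * r).
have rho1 : 1 <= rho by rewrite /rho le_max lexx.
have tk := @riesz_kernel_truncated R m alpha _ rho1.
have OO x : Omega x -> Omega `<=` eball x rho.
  move=> /Or + y /Or; rewrite /eball /= !subr0 => xr yr.
  apply: le_lt_trans (ler_enormD _ _) _; rewrite enormN.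
  have : 2 * r <= rho by rewrite /rho le_max lexx orbT.
  by lra.
have [||x Ox xmin] := @lsc_compact_min R _ (W rho) Omega _ _ Omega_body.1 Omega_neq0.
- by move=> x; exact: (defect_ge0 _ _ tk).
- exact: (defect_lsc tk cO).
have [C h] := objective_defect rho1.
have [z iz] := interior_neq0.
have Oz := interior_subset iz.
have Wx : (W rho x < +oo)%E.
  apply: le_lt_trans (xmin _ Oz) _.
  have Dz : D z by rewrite DI.
  exact (h z Dz (OO _ Oz)).1.
have ix : Omega° x.
  apply: contrapT => nix; move: Wx; rewrite (defect_boundary m2 a0 rho1 cO) ?ltxx//.
  by apply: cone; split => //; exact: subset_closure.
have Dx : D x by rewrite DI.
exists x; split; first exact: Dx.
move=> y Dy; have Oy : Omega y by apply: interior_subset; rewrite -DI.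
have [_ ->] := h y Dy (OO y Oy); have [_ ->] := h x Dx (OO x Ox).
exact: leeB (lexx _) (xmin _ Oy).
Qed.

End centers.

Unset Implicit Arguments.

Theorem theorem3p5 (R : realType) (m : nat) (Omega : set 'rV[R]_m)
    (hm : (2 <= m)%N)
    (Omega_neq0 : Omega !=set0)
    (Omega_body : body Omega)
    (Omega_pC1 : piecewise_C1_boundary Omega)
    (Omega_cone : forall z, boundary Omega z -> exterior_cone_condition Omega z) :
  forall alpha : R,
    exists x, minimal_unfolded_region Omega x /\ is_center alpha Omega x.
Proof.
move=> alpha.
have [x mx] : exists x, max_on (center_domain alpha Omega) (objective alpha Omega) x.
  have [a0|a0] := leP alpha 0; first exact: center_exists_nonpos.
  exact: center_exists_pos.
exists x; split; first exact: center_minimal_unfolded_region mx.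
exact: is_center_objective.
Qed.
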